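(* Let $\mathbf{k}$ be a field of characteristic $0$ and $R$ a (commutative) $\mathbf{k}$-algebra of countable dimension over $\mathbf{k}$. For $k=1,2$, let $I_k$ be a countable set and $(\mathcal{H}_k,\nabla_k)/R[[t_j, j\in I_k]]$ an F-bundle. Let $(f,\Phi):(\mathcal{H}_1,\nabla_1)_0\to(\mathcal{H}_2,\nabla_2)_0$ be a morphism of the underlying (T)-structures. Assume the (T)-structure $(\mathcal{H}_1,\nabla_1)_0$ admits a framing. Then: 1. $\nabla_1$ is uniquely determined by the underlying (T)-structure and $\nabla_{1,\partial_u}|_{t_{I_1}=0}$, and any such data (the given (T)-structure together with a connection in the $u$-direction $\mathcal{H}_1|_{t_{I_1}=0}\to u^{-2}\mathcal{H}_1|_{t_{I_1}=0}$) determine a unique F-bundle connection extending the (T)-structure and restricting to the given $u$-direction connection at $t_{I_1}=0$. 2. $(f,\Phi)$ is an isomorphism of F-bundles if and only if $(f,\Phi)|_{t_{I_1}=0}$ is an isomorphism of F-bundles.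
   Context: For a countable set $S$ and variables $t_S=\{t_s\}_{s\in S}$, $M[[t_S]]$ denotes all formal sums $\sum_\alpha a_\alpha t_S^\alpha$ over finitely supported $\alpha\in\mathbb{N}^{(S)}$ with $a_\alpha\in M$, with the topology of coefficientwise convergence ($M$ and $R$ discrete). For a free $R$-module $H$, $H\otimes_RR[[t_S]]$ is identified with $H[[t_S]]$, and morphisms $H[[t_S]]\to H'[[t_S]]$ are identified with elements of $\operatorname{Hom}_R(H,H')[[t_S]]$. ''$|_{t_S=0}$'' means restriction to $t_S=0$, i.e. quotient by the closure of the ideal $(t_S)$. An ($R$-linear) (T)-structure $(\mathcal{H},\nabla)/R[[t_S]]$ is a free $R[[t_S,u]]$-module $\mathcal{H}$ (rank possibly infinite) with a flat $R$-linear connection in the $t$-directions $\nabla_{\partial_{t_s}}:\mathcal{H}\to u^{-1}\mathcal{H}$. An ($R$-linear) F-bundle has in addition an operator $\nabla_{\partial_u}:\mathcal{H}\to u^{-2}\mathcal{H}$ such that the whole $R$-linear connection is flat. $(\cdot)_0$ denotes forgetting $\nabla_{\partial_u}$, which gives the underlying (T)-structure. A morphism of (T)-structures (resp. F-bundles) $(f,\Phi):(\mathcal{H},\nabla)/R[[t_S]]\to(\mathcal{H}',\nabla')/R[[t_{S'}]]$ consists of a continuous $R$-algebra map $f:R[[t_{S'}]]\to R[[t_S]]$ and a continuous $R[[t_S,u]]$-linear map $\Phi:\mathcal{H}\to f^*\mathcal{H}'=\mathcal{H}'\otimes_{R[[t_{S'},u]]}R[[t_S,u]]$ with $\Phi\circ\nabla=f^*\nabla'\circ\Phi$.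 A framing of a (T)-structure is an isomorphism $\mathcal{H}\simeq H\otimes_RR[[t_S,u]]$, with $H$ a free $R$-module, in which $\nabla_{\partial_{t_s}}=\partial_{t_s}+u^{-1}A_s(t)$ with $A_s\in\operatorname{End}_R(H)[[t_S]]$ independent of $u$ for all $s$.
   Formalization: The u-connection extending arbitrary data may have a pole of order 2+|a| at t^a (order 2 can fail); it is the F-bundle connection whenever one extends the data. In 2, isomorphism means Φ: H_1→f^*H_2 is one; f need not be invertible, else the ''if'' direction fails. *)

(* Defs.v *)
From HB Require Import structures.
From mathcomp Require Import all_boot all_order all_algebra finmap.
From mathcomp Require Import boolp classical_sets functions cardinality.
From mathcomp Require Import fsbigop.

Set Implicit Arguments.
Unset Strict Implicit.
Unset Printing Implicit Defensive.
Import Order.TTheory GRing.Theory Num.Theory.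
Local Open Scope ring_scope.
Local Open Scope classical_set_scope.

(* [sc] is the scalar action: it is [*:%R] for a module, and
   [fun c x => iota c * x] for an algebra given by its structure map iota. *)
Definition is_basis (K : pzRingType) (V : zmodType) (sc : K -> V -> V)
    (B : set V) : Prop :=
  forall v : V, exists! c : {fsfun V -> K with 0},
    (forall x, x \in finsupp c -> B x) /\
    v = \sum_(x <- finsupp c) sc (c x) x.

Definition countable_dim (k : fieldType) (R : comPzRingType)
    (iota : {rmorphism k -> R}) : Prop :=
  exists2 B : set R, countable B & is_basis (fun c x => iota c * x) B.

Definition is_free (R : pzRingType) (H : lmodType R) : Prop :=
  exists B : set H, is_basis *:%R B.

(** Formal series *)

Notation mon S := {fsfun S -> nat with 0%N}.

Definition mon1 (S : countType) : mon S := [fsfun].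

Definition mulvar (S : countType) (s : S) (a : mon S) : mon S :=
  [fsfun a with s |-> (a s).+1].

Definition mdeg (S : countType) (a : mon S) : nat :=
  (\sum_(s <- finsupp a) a s)%N.

Definition factors (S : countType) (a : mon S) : set (mon S * mon S) :=
  [set p : mon S * mon S | forall s, (p.1 s + p.2 s)%N = a s].

(* M[[t_S]] *)
Notation ser S M := (mon S -> M).

(* [v : lser S M] stands for the formal sum of the v a n t^a u^n, with a in
   N^(S) and n in Z; the modules of the theory are cut out by the two
   predicates below. *)
Notation lser S M := (mon S -> int -> M).

(* The power of u at t^a is at least - p a.  Thus u^-k M[[t_S, u]] is
   [pole_le (fun=> k%:Z)], and M[[t_S, u]] is [pole_le (fun=> 0)]. *)
Definition pole_le (S : countType) (M : zmodType) (p : mon S -> int)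
    (v : lser S M) : Prop :=
  forall a n, n < - p a -> v a n = 0.

(* M((u))[[t_S]].  It contains u^-k M[[t_S, u]] for all k.  Connections and
   morphisms are u-linear up to a derivation and continuous, so they extend
   uniquely from M[[t_S, u]] to M((u))[[t_S]]; this is where they are composed
   and compared.  Values outside of M((u))[[t_S]] are never used. *)
Definition laurent (S : countType) (M : zmodType) (v : lser S M) : Prop :=
  exists p, pole_le p v.

Definition agree (S S' : countType) (M M' : zmodType)
    (F G : lser S M -> lser S' M') : Prop :=
  forall v, laurent v -> F v = G v.

Definition emb (S : countType) (M : zmodType) (g : ser S M) : lser S M :=
  fun a n => if n == 0 then g a else 0.

Definition csec (S : countType) (M : zmodType) (h : M) : lser S M :=
  emb (fun a => if a == mon1 S then h else 0).

Definition tmon (S : countType) (R : pzRingType) (b : mon S) : ser S R :=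
  fun a => (a == b)%:R.

Definition tvar (S : countType) (R : pzRingType) (s : S) : ser S R :=
  tmon R (mulvar s (mon1 S)).

Definition dt (S : countType) (M : zmodType) (s : S) (v : lser S M)
    : lser S M :=
  fun a n => v (mulvar s a) n *+ (a s).+1.

Definition du (S : countType) (M : zmodType) (v : lser S M) : lser S M :=
  fun a n => v a (n + 1) *~ (n + 1).

(* The extension of phi : H -> H'((u))[[t_S]] to H((u))[[t_S]], linear over
   R((u))[[t_S]] and continuous: it sends the sum of the h_(a,n) t^a u^n to the
   sum of the t^a u^n phi(h_(a,n)).  Each coefficient is a finite sum on
   Laurent series. *)
Definition ext (S : countType) (H H' : zmodType) (phi : H -> lser S H')
    (v : lser S H) : lser S H' :=
  fun a n => \sum_(p \in factors a) \sum_(i \in [set: int])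
    phi (v p.2 i) p.1 (n - i).

Definition lmul (S : countType) (R : pzRingType) (H : lmodType R)
    (g : lser S R) (v : lser S H) : lser S H :=
  ext (fun h b j => g b j *: h) v.

(** Continuous maps *)

(* Continuity for coefficientwise convergence, on each of the modules
   [pole_le p] (on H[[t_S, u]] for p = 0), coefficients being discrete. *)
Definition lcontinuous (S S' : countType) (M M' : zmodType)
    (F : lser S M -> lser S' M') : Prop :=
  forall p v a n, pole_le p v -> exists E : {fset mon S * int},
    forall w, pole_le p w -> (forall e, e \in E -> w e.1 e.2 = v e.1 e.2) ->
      F w a n = F v a n.

Definition rlinear (S S' : countType) (R : pzRingType) (H H' : lmodType R)
    (F : lser S H -> lser S' H') : Prop :=
  forall (r : R) v w, laurent v -> laurent w ->
    F (fun a n => r *: v a n + w a n) = (fun a n => r *: F v a n + F w a n).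

(* Continuous R-algebra maps R[[t_S']] -> R[[t_S]] *)
Definition is_alg_map (S' S : countType) (R : comPzRingType)
    (f : ser S' R -> ser S R) : Prop :=
  let mul (T : countType) (g h : ser T R) : ser T R :=
    fun a => \sum_(p \in factors a) g p.1 * h p.2 in
  [/\ forall r g h, f (fun a => r * g a + h a) = (fun a => r * f g a + f h a),
      f (tmon R (mon1 S')) = tmon R (mon1 S),
      forall g h, f (mul S' g h) = mul S (f g) (f h)
    & forall g a, exists E : {fset mon S'},
        forall h, {in E, h =1 g} -> f h a = f g a].

(* Continuous R[[t_S, u]]-linear maps H[[t_S, u]] -> H'[[t_S, u]] *)
Definition is_linear_map (S : countType) (R : comPzRingType)
    (H H' : lmodType R) (Phi : lser S H -> lser S H') : Prop :=
  [/\ forall v, laurent v -> laurent (Phi v),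
      rlinear Phi,
      forall (g : lser S R) v, laurent g -> laurent v ->
        Phi (lmul g v) = lmul g (Phi v),
      forall v, pole_le (fun=> 0) v -> pole_le (fun=> 0) (Phi v)
    & lcontinuous Phi].

Definition is_linear_iso (S : countType) (R : comPzRingType)
    (H H' : lmodType R) (Phi : lser S H -> lser S H') : Prop :=
  is_linear_map Phi /\
  exists Psi, [/\ is_linear_map Psi, agree (Psi \o Phi) id
                & agree (Phi \o Psi) id].

(** (T)-structures and F-bundles *)

(* An operator N : H[[t_S, u]] -> sum of the u^(- p a) t^a H[[u]] satisfying
   the Leibniz rule for the derivation d. *)
Definition is_conn (S : countType) (R : comPzRingType) (H : lmodType R)
    (d : lser S R -> lser S R) (p : mon S -> int)
    (N : lser S H -> lser S H) : Prop :=
  [/\ forall v, laurent v -> laurent (N v),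
      rlinear N,
      forall (g : lser S R) v, laurent g -> laurent v ->
        N (lmul g v) = (fun a n => lmul (d g) v a n + lmul g (N v) a n),
      forall v, pole_le (fun=> 0) v -> pole_le p (N v)
    & lcontinuous N].

Definition commutes (S : countType) (H : zmodType)
    (N N' : lser S H -> lser S H) : Prop :=
  agree (N \o N') (N' \o N).

(* The module is H[[t_S, u]], for H = tcar or fcar. *)
Record Tdata (R : comPzRingType) (S : countType) := MkT {
  tcar : lmodType R;
  tnt : S -> lser S tcar -> lser S tcar }.

Record Fdata (R : comPzRingType) (S : countType) := MkF {
  fcar : lmodType R;
  fnt : S -> lser S fcar -> lser S fcar;
  fnu : lser S fcar -> lser S fcar }.

Arguments tnt {R S} X _ _ : rename.
Arguments fnt {R S} X _ _ : rename.
Arguments fnu {R S} X _ : rename.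

Definition forget (R : comPzRingType) (S : countType) (X : Fdata R S)
    : Tdata R S := MkT (fnt X).

Definition with_nu (R : comPzRingType) (S : countType) (X : Tdata R S)
    (D : lser S (tcar X) -> lser S (tcar X)) : Fdata R S :=
  MkF (tnt X) D.

Arguments with_nu {R S} X D.

Definition is_Tstructure (R : comPzRingType) (S : countType) (X : Tdata R S)
    : Prop :=
  [/\ is_free (tcar X),
      forall s, is_conn (dt s) (fun=> 1) (tnt X s)
    & forall s s', commutes (tnt X s) (tnt X s')].

(* D extends the (T)-structure X to a flat connection, with the pole of D
   along u = 0 bounded by p.  F-bundles have p = 2.  An arbitrary u-connection
   at t = 0 need not extend with p = 2: solving the flatness equations in t
   raises the order of the pole by at most one for each degree in t, hence the
   use of p a = 2 + mdeg a.  E.g. for nabla_t = d/dt + u^-1 E_12 on k^2[[t, u]],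
   flatness with p = 2 forces the u^-2 term at t = 0 to commute with E_12. *)
Definition flat_extension (R : comPzRingType) (S : countType) (X : Tdata R S)
    (p : mon S -> int) (D : lser S (tcar X) -> lser S (tcar X)) : Prop :=
  is_conn (@du S R) p D /\ forall s, commutes (tnt X s) D.

Arguments flat_extension {R S} X p D.

Definition is_Fbundle (R : comPzRingType) (S : countType) (X : Fdata R S)
    : Prop :=
  is_Tstructure (forget X) /\
  flat_extension (forget X) (fun=> 2) (fnu X).

(* Isomorphisms over the identity of R[[t_S]] *)
Definition is_Tiso (R : comPzRingType) (S : countType) (X Y : Tdata R S)
    (Phi : lser S (tcar X) -> lser S (tcar Y)) : Prop :=
  is_linear_iso Phi /\ forall s, agree (Phi \o tnt X s) (tnt Y s \o Phi).

Arguments is_Tiso {R S} X Y Phi.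

Definition is_Fiso (R : comPzRingType) (S : countType) (X Y : Fdata R S)
    (Phi : lser S (fcar X) -> lser S (fcar Y)) : Prop :=
  is_Tiso (forget X) (forget Y) Phi /\
  agree (Phi \o fnu X) (fnu Y \o Phi).

Arguments is_Fiso {R S} X Y Phi.

(* d/dt_s + u^-1 A_s(t), where A s a is the coefficient of t^a in A_s *)
Definition framed_nt (R : comPzRingType) (S : countType) (H : lmodType R)
    (A : S -> mon S -> {linear H -> H}) (s : S) (v : lser S H) : lser S H :=
  fun a n => dt s v a n + \sum_(p \in factors a) A s p.1 (v p.2 (n + 1)).

Definition admits_framing (R : comPzRingType) (S : countType) (X : Tdata R S)
    : Prop :=
  exists (H : lmodType R) (A : S -> mon S -> {linear H -> H})
         (Phi : lser S (tcar X) -> lser S H),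
    is_free H /\ is_Tiso X (MkT (framed_nt A)) Phi.

(** Pullback along f : R[[t_S']] -> R[[t_S]] *)

(* v |-> v (x) 1, from H[[t_S', u]] to f^* H[[t_S', u]] = H[[t_S, u]]; the sum
   is finite because f (t^b) tends to 0. *)
Definition pullv (S' S : countType) (R : comPzRingType) (H : lmodType R)
    (f : ser S' R -> ser S R) (v : lser S' H) : lser S H :=
  fun a n => \sum_(b \in [set: mon S']) f (tmon R b) a *: v b n.

(* (f^* nabla)_(d/dt_s) (h (x) 1) =
     sum over r of d(f t_r)/dt_s . (nabla_(d/dt_r) h) (x) 1,
   extended from h in H by the Leibniz rule and continuity. *)
Definition pull_nt (S' S : countType) (R : comPzRingType) (H : lmodType R)
    (f : ser S' R -> ser S R) (nt : S' -> lser S' H -> lser S' H) (s : S)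
    (w : lser S H) : lser S H :=
  fun a n => dt s w a n +
    ext (fun (h : H) b j => \sum_(r \in [set: S'])
           lmul (dt s (emb (f (tvar R r)))) (pullv f (nt r (csec h))) b j)
        w a n.

Definition pull_nu (S' S : countType) (R : comPzRingType) (H : lmodType R)
    (f : ser S' R -> ser S R) (nu : lser S' H -> lser S' H)
    (w : lser S H) : lser S H :=
  fun a n => du w a n + ext (fun h : H => pullv f (nu (csec h))) w a n.

Definition pullT (R : comPzRingType) (S' S : countType)
    (f : ser S' R -> ser S R) (Y : Tdata R S') : Tdata R S :=
  MkT (pull_nt f (tnt Y)).

Definition pullF (R : comPzRingType) (S' S : countType)
    (f : ser S' R -> ser S R) (Y : Fdata R S') : Fdata R S :=
  MkF (pull_nt f (fnt Y)) (pull_nu f (fnu Y)).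

Definition is_Tmorphism (R : comPzRingType) (S S' : countType)
    (X : Tdata R S) (Y : Tdata R S') (f : ser S' R -> ser S R)
    (Phi : lser S (tcar X) -> lser S (tcar Y)) : Prop :=
  [/\ is_alg_map f, is_linear_map Phi
    & forall s, agree (Phi \o tnt X s) (tnt (pullT f Y) s \o Phi)].

Arguments is_Tmorphism {R S S'} X Y f Phi.

(* (f, Phi) is an isomorphism of F-bundles when Phi identifies (H, nabla) with
   (f^* H', f^* nabla').  The map f itself need not be
   invertible, which the restriction to t_S = 0 could not detect. *)
Definition is_Fisomorphism (R : comPzRingType) (S S' : countType)
    (X : Fdata R S) (Y : Fdata R S') (f : ser S' R -> ser S R)
    (Phi : lser S (fcar X) -> lser S (fcar Y)) : Prop :=
  is_alg_map f /\ is_Fiso X (pullF f Y) Phi.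

Arguments is_Fisomorphism {R S S'} X Y f Phi.

(** Restriction to t_S = 0, as objects over R[[t_void]] = R *)

Definition at0 (S : countType) (M : zmodType) (v : lser S M) : lser void M :=
  fun _ n => v (mon1 S) n.

Definition lift0 (S : countType) (M : zmodType) (w : lser void M)
    : lser S M :=
  fun a n => if a == mon1 S then w (mon1 void) n else 0.

(* The map induced by F on the quotients at t_S = 0; it does not depend on the
   lift when F is R[[t_S]]-linear and continuous, so in particular when F is
   [fnu] or a morphism. *)
Definition restr (S : countType) (M M' : zmodType)
    (F : lser S M -> lser S M') (w : lser void M) : lser void M' :=
  at0 (F (lift0 w)).

Definition restrF (R : comPzRingType) (S : countType) (X : Fdata R S)
    : Fdata R void :=
  MkF (fun s : void => match s with end) (restr (fnu X)).

(* Main.v *)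
Require Import Defs.
From HB Require Import structures.
From mathcomp Require Import all_boot all_order all_algebra finmap.
From mathcomp Require Import boolp classical_sets functions cardinality.
From mathcomp Require Import fsbigop.
From mathcomp Require Import zify.

Set Implicit Arguments.
Unset Strict Implicit.
Unset Printing Implicit Defensive.
Import Order.TTheory GRing.Theory Num.Theory.
Local Open Scope ring_scope.
Local Open Scope classical_set_scope.

(** Write N_s for the operator nabla_(d/dt_s) of the (T)-structure.

    Uniqueness is an induction on the degree in t. If E intertwines two
    t-connections N1 and N2 and vanishes at t = 0, then E = 0
    ([intertwiner_eq0]): the equation N2_s (E v) = E (N1_s v) computes the
    coefficient of t_s t^a in E v, times a_s + 1, from coefficients of lower
    degree, and a_s + 1 is invertible in characteristic 0. The difference of
    two u-connections that commute with N and agree at t = 0 is such an E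
    ([flat_extension_unique]).

    For existence, the Taylor map T v = sum of the t^b / b! (N^b v)(0)
    identifies N_s with d/dt_s, because the N_s commute, and it is the identity
    at t = 0 ([taylor], [dt_taylor], [at0_taylor]). It is linear by the
    uniqueness principle ([taylor_tm]), and it is invertible by a Neumann series
    in t ([neumann]). A u-connection delta at t = 0, acting on each coefficient
    of a series in t, commutes with d/dt_s, and conjugating it by T gives the
    extension ([flat_ext]). Each N_s increases the order of the pole by at most
    one, so T and its inverse respect bounds of the form m + |a| on the pole at
    t^a; this is where the bound 2 + |a| comes from.

    In the second part, a linear map that is invertible at t = 0 is invertible,
    by a Neumann series in t again ([linear_iso_of_restr]). If Phi is moreover
    compatible with the u-connections at t = 0, then
    E = Phi nabla_1,u - (f^* nabla_2)_u Phi vanishes at t = 0. It intertwines N1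
    and f^* N2 because Phi is a morphism of (T)-structures and because the
    pullback of a flat connection is flat ([pull_flat]), so E = 0. Flatness of
    the pullback needs to be checked on sections v (x) 1 only, where f^* N2 is
    given by the chain rule ([pull_nt_pullv]).

    All identities between operators are reduced to constant sections by
    continuity ([op_eq_gens]). Linear maps and connections are determined by
    their symbols, the values on constant sections, whose poles are uniformly
    bounded ([symbol_rep], [conn_rep]); so they can be composed without losing
    continuity. *)

(** * Monomials *)

Definition unvar (S : countType) (s : S) (a : mon S) : mon S :=
  [fsfun a with s |-> (a s).-1].

Section Monomials.
Variable S : countType.
Implicit Types (a b : mon S) (s r : S).

Lemma mon1E s : mon1 S s = 0%N.
Proof. by rewrite fsfun0E. Qed.

Lemma mulvarE s a r : mulvar s a r = (a r + (r == s))%N.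
Proof.
by rewrite /mulvar fsfun_withE; case: eqP => [->|_]; rewrite ?addn1 ?addn0.
Qed.

Lemma unvarE s a r : unvar s a r = (a r - (r == s))%N.
Proof.
by rewrite /unvar fsfun_withE; case: eqP => [->|_]; rewrite ?subn1 ?subn0.
Qed.

Lemma mulvarK s : cancel (mulvar s) (unvar s).
Proof. by move=> a; apply/fsfunP => r; rewrite unvarE mulvarE addnK. Qed.

Lemma unvarK s a : a s != 0%N -> mulvar s (unvar s a) = a.
Proof.
move=> as0; apply/fsfunP => r; rewrite mulvarE unvarE.
by case: eqP => [->|_]; lia.
Qed.

Lemma unvar_mulvar s r a : r != s -> unvar s (mulvar r a) = mulvar r (unvar s a).
Proof.
move=> rs; apply/fsfunP => x; rewrite !(unvarE, mulvarE).
by case: (x =P s) => [->|]; rewrite ?(eq_sym s) ?(negPf rs); lia.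
Qed.

Lemma mdegE (A : {fset S}) a : (finsupp a `<=` A)%fset ->
  mdeg a = (\sum_(s <- A) a s)%N.
Proof.
move=> aA; rewrite /mdeg (big_fset_incl _ aA) // => s _.
by rewrite memNfinsupp => /eqP.
Qed.

Lemma mdeg_factors a p : factors a p -> mdeg a = (mdeg p.1 + mdeg p.2)%N.
Proof.
move=> fp; pose A := (finsupp a `|` (finsupp p.1 `|` finsupp p.2))%fset.
rewrite !(@mdegE A); first by rewrite -big_split; apply: eq_bigr => s _; rewrite -fp.
all: by apply/fsubsetP => s; rewrite !in_fsetU => ->; rewrite ?orbT.
Qed.

Lemma mdeg_mulvar s a : mdeg (mulvar s a) = (mdeg a).+1.
Proof.
have -> : mdeg (mulvar s a) = (mdeg (mulvar s (mon1 S)) + mdeg a)%N.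
  by apply: (@mdeg_factors _ (mulvar s (mon1 S), a)) => r /=; rewrite !mulvarE mon1E; lia.
rewrite (@mdegE [fset s]%fset) ?big_seq_fset1 ?mulvarE ?mon1E ?eqxx //.
apply/fsubsetP => r; rewrite in_fset1 mem_finsupp mulvarE mon1E.
by case: (r == s).
Qed.

Lemma mon_cases a : a = mon1 S \/ exists s b, a = mulvar s b.
Proof.
case: (pselect (exists s, a s != 0%N)) => [[s as0]|no].
  by right; exists s, (unvar s a); rewrite unvarK.
left; apply/fsfunP => s; rewrite mon1E; apply/eqP/negPn/negP => as0.
by apply: no; exists s.
Qed.

Lemma mulvar_neq1 s a : mulvar s a <> mon1 S.
Proof. by move=> /(congr1 (fun b : mon S => b s)); rewrite mulvarE mon1E eqxx addn1. Qed.

Lemma mon_ind (P : mon S -> Prop) :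
  P (mon1 S) -> (forall s a, P a -> P (mulvar s a)) -> forall a, P a.
Proof.
move=> P1 PS a; have [n] := ubnP (mdeg a); elim: n => // n IHn in a *.
case: (mon_cases a) => [->//|[s [b ->]]]; rewrite mdeg_mulvar => ?.
by apply: PS; apply: IHn; lia.
Qed.

Lemma factors1 : factors (mon1 S) = [set (mon1 S, mon1 S)].
Proof.
apply/seteqP; split=> [[b c] /= fbc|_ -> s]; last by rewrite /= mon1E.
by congr pair; apply/fsfunP => s; move: (fbc s) => /=; rewrite mon1E; lia.
Qed.

Lemma finite_factors a : finite_set (factors a).
Proof.
elim/mon_ind: a => [|s a IHa]; first by rewrite factors1.
apply: (@sub_finite_set _ _ ((fun p => (mulvar s p.1, p.2)) @` factors a `|`
                              (fun p => (p.1, mulvar s p.2)) @` factors a)).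
  move=> [b c] /= fbc; have [b0|b0] := eqVneq (b s) 0%N.
    have c0 : c s != 0%N by have := fbc s; rewrite mulvarE eqxx /= b0; lia.
    right; exists (b, unvar s c); rewrite /= ?unvarK // => r.
    have := fbc r; rewrite /= mulvarE unvarE.
    by case: (r =P s) => [->|] /=; lia.
  left; exists (unvar s b, c); rewrite /= ?unvarK // => r.
  have := fbc r; rewrite /= mulvarE unvarE.
  by case: (r =P s) => [->|] /=; lia.
by rewrite finite_setU; split; apply: finite_image.
Qed.

Lemma factors_swap a p : factors a p -> factors a (p.2, p.1).
Proof. by move=> fp s; rewrite /= addnC. Qed.

Lemma factors_1l a : factors a (mon1 S, a).
Proof. by move=> s; rewrite /= mon1E. Qed.

Lemma factors_eq1 a p : factors a p -> p.1 = mon1 S -> p.2 = a.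
Proof. by move=> fp p1; apply/fsfunP => s; rewrite -(fp s) p1 mon1E. Qed.

Lemma factors_eq0 a p s : factors a p -> a s = 0%N -> p.2 s = 0%N.
Proof. by move=> /(_ s) <-; lia. Qed.

Lemma factors_unvar a p s : factors (mulvar s a) p -> p.2 s <> 0%N ->
  factors a (p.1, unvar s p.2).
Proof.
move=> fp ps r; have := fp r; rewrite /= mulvarE unvarE.
by case: (r =P s) => [->|] /=; move: ps; lia.
Qed.

Lemma factors_mulvar a p s : factors a p -> factors (mulvar s a) (p.1, mulvar s p.2).
Proof. by move=> fp r; rewrite /= !mulvarE -(fp r) addnA. Qed.

Lemma factors_trans a p q : factors a p -> factors p.2 q ->
  exists b, factors a (b, q.2).
Proof.
move=> fp fq; suff [b bE] : exists b : mon S, forall s, b s = (p.1 s + q.1 s)%N.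
  by exists b => s /=; rewrite bE -(fp s) -(fq s) addnA.
elim/mon_ind: p.1 => [|s c [b bE]].
  by exists q.1 => r; rewrite mon1E.
by exists (mulvar s b) => r; rewrite !mulvarE bE addnAC.
Qed.

End Monomials.

(** * Continuous operators on Laurent series *)

Section Poles.
Variables (S : countType) (M : zmodType).
Implicit Types (v w : lser S M) (p : mon S -> int).

Lemma pole_le_weak p p' v :
  (forall a, p a <= p' a) -> pole_le p v -> pole_le p' v.
Proof. by move=> pp' pv a n an; apply: pv; move: (pp' a); lia. Qed.

Lemma pole_leB p v w : pole_le p v -> pole_le p w -> pole_le p (v - w).
Proof.
move=> pv pw a n an; rewrite -[LHS]/(v a n - w a n).
by rewrite (pv _ _ an) (pw _ _ an) subrr.
Qed.

Lemma pole_le0 p : pole_le p (0 : lser S M).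
Proof. by []. Qed.

Lemma pole_leN p v : pole_le p v -> pole_le p (- v).
Proof. by rewrite -[- v]sub0r => pv; apply: pole_leB => //; apply: pole_le0. Qed.

Lemma pole_leD p v w : pole_le p v -> pole_le p w -> pole_le p (v + w).
Proof. by move=> pv pw; rewrite -[w]opprK; apply: pole_leB (pole_leN pw). Qed.

Lemma laurent_common v w : laurent v -> laurent w ->
  exists2 p, pole_le p v & pole_le p w.
Proof.
move=> [p pv] [q qw]; exists (fun a => Num.max (p a) (q a)).
  by apply: pole_le_weak pv => a; rewrite le_max lexx.
by apply: pole_le_weak qw => a; rewrite le_max lexx orbT.
Qed.

Lemma laurentB v w : laurent v -> laurent w -> laurent (v - w).
Proof.
by move=> lv lw; have [p pv pw] := laurent_common lv lw; exists p; apply: pole_leB.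
Qed.

Lemma laurent0 : laurent (0 : lser S M).
Proof. by exists (fun=> 0). Qed.

Lemma laurentN v : laurent v -> laurent (- v).
Proof. by rewrite -[- v]sub0r; apply: laurentB; exact: laurent0. Qed.

Lemma laurentD v w : laurent v -> laurent w -> laurent (v + w).
Proof. by move=> lv lw; rewrite -[w]opprK; apply: laurentB => //; apply: laurentN. Qed.

Lemma laurent_sum I (l : seq I) (W : I -> lser S M) :
  (forall i, laurent (W i)) -> laurent (\sum_(i <- l) W i).
Proof.
by move=> lW; elim/big_ind: _ => // [|x y]; [exact: laurent0|exact: laurentD].
Qed.

Definition mono (b : mon S) (i : int) (h : M) : lser S M :=
  fun a n => if (a == b) && (n == i) then h else 0.

Lemma pole_le_mono p b i h : - p b <= i \/ h = 0 -> pole_le p (mono b i h).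
Proof.
move=> ih a n an; rewrite /mono; case: eqP => //= ab; case: eqP => //= ni.
by case: ih => //; move: an; rewrite ab ni; lia.
Qed.

Lemma laurent_mono b i h : laurent (mono b i h).
Proof. by exists (fun=> - i); apply: pole_le_mono; left; lia. Qed.

End Poles.

#[local] Hint Resolve pole_le0 laurent0 laurent_mono : core.

(** A structure common to connections, morphisms and pullbacks, which obey
    different Leibniz rules. Continuity only makes sense on series with a
    common bound on their poles, so a uniform bound on the poles of the images
    is what makes such operators composable. *)
Definition op (S S' : countType) (M M' : zmodType)
    (F : lser S M -> lser S' M') : Prop :=
  [/\ forall v w, laurent v -> laurent w -> F (v - w) = F v - F w,
      forall p, exists p', forall v, pole_le p v -> pole_le p' (F v)
    & forall p a n, exists E : {fset mon S * int}, forall v, pole_le p v ->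
        (forall e, e \in E -> v e.1 e.2 = 0) -> F v a n = 0].

Section Op.
Variables (S S' : countType) (M M' : zmodType).
Implicit Types (F G : lser S M -> lser S' M').

Lemma op_laurent F v : op F -> laurent v -> laurent (F v).
Proof. by case=> _ bF _ [p pv]; have [p' h] := bF p; exists p'; apply: h. Qed.

Lemma opB F v w : op F -> laurent v -> laurent w -> F (v - w) = F v - F w.
Proof. by case=> h _ _; apply: h. Qed.

Lemma op0 F : op F -> F 0 = 0.
Proof. by move=> oF; rewrite -(subrr 0) opB // subrr. Qed.

Lemma opN F v : op F -> laurent v -> F (- v) = - F v.
Proof. by move=> oF lv; rewrite -sub0r opB // op0 // sub0r. Qed.

Lemma opD F v w : op F -> laurent v -> laurent w -> F (v + w) = F v + F w.
Proof.
by move=> oF lv lw; rewrite -{1}[w]opprK opB // ?opN ?opprK //; apply: laurentN.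
Qed.

Lemma op_big F I (l : seq I) (W : I -> lser S M) :
    op F -> (forall i, laurent (W i)) ->
  F (\sum_(i <- l) W i) = \sum_(i <- l) F (W i).
Proof.
move=> oF lW; elim: l => [|i l IHl]; first by rewrite !big_nil op0.
by rewrite !big_cons (opD oF) ?IHl //; apply: laurent_sum.
Qed.

Lemma op_lcontinuous F : op F -> lcontinuous F.
Proof.
move=> oF p v a n pv; case: (oF) => _ _ /(_ p a n) [E EP]; exists E => w pw wv.
have: F (w - v) a n = 0.
  apply: EP; first exact: pole_leB.
  by move=> e eE; rewrite -[LHS]/(w e.1 e.2 - v e.1 e.2) wv // subrr.
rewrite opB //; [|by exists p..].
by rewrite -[X in X = _]/(F w a n - F v a n) => /subr0_eq.
Qed.

Lemma lcontinuousB F G :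
  lcontinuous F -> lcontinuous G -> lcontinuous (fun v => F v - G v).
Proof.
move=> cF cG p v a n pv; have [E EP] := cF p v a n pv; have [E' EP'] := cG p v a n pv.
exists (E `|` E')%fset => w pw wv.
rewrite -[LHS]/(F w a n - G w a n) EP ?EP' // => e eE; apply: wv.
  by rewrite in_fsetU eE orbT.
by rewrite in_fsetU eE.
Qed.

(** A Laurent series is a limit of finite sums of monomials, along series with
    the same bound on the poles. *)
Lemma eq0_of_mono (F : lser S M -> lser S' M') :
    (forall v w, laurent v -> laurent w -> F (v - w) = F v - F w) ->
    lcontinuous F -> (forall b i h, F (mono b i h) = 0) ->
  forall v, laurent v -> F v = 0.
Proof.
move=> FB cF F0 v [p pv]; apply/funext => a; apply/funext => n.
have [E EP] := cF p v a n pv.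
have FD w w' : laurent w -> laurent w' -> F (w + w') = F w + F w'.
  have F00 : F 0 = 0 by rewrite -(subrr 0) FB // subrr.
  have FN u : laurent u -> F (- u) = - F u.
    by move=> lu; rewrite -sub0r FB // F00 sub0r.
  by move=> lw lw'; rewrite -{1}[w']opprK FB ?FN ?opprK //; apply: laurentN.
pose w := \sum_(e <- E) mono e.1 e.2 (v e.1 e.2).
have [pw Fw] : pole_le p w /\ F w = 0.
  rewrite /w; elim/big_ind: _ => [|x y [px Fx] [py Fy]|e _].
  - by split=> //; rewrite -(subrr 0) FB // subrr.
  - split; first exact: pole_leD.
    by rewrite FD ?Fx ?Fy ?addr0 //; exists p.
  - split=> //; apply: pole_le_mono.
    by case: (leP (- p e.1) e.2) => h; [left|right; apply: pv].
rewrite -(EP w pw) ?Fw // => e eE.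
rewrite /w !fct_sumE (big_fsetD1 e) //= big_seq big1 ?addr0 /mono ?eqxx // => e'.
rewrite in_fsetD1 => /andP[e'e _].
by rewrite -pair_eqE /= in e'e; rewrite eq_sym (eq_sym e.2) (negPf e'e).
Qed.

Lemma op_eq_mono F G : op F -> op G ->
  (forall b i h, F (mono b i h) = G (mono b i h)) -> agree F G.
Proof.
move=> oF oG FG v lv; apply/eqP; rewrite -subr_eq0; apply/eqP.
apply: (@eq0_of_mono (fun v => F v - G v)) => //.
- by move=> x y lx ly; rewrite (opB oF) // (opB oG) // !opprD !opprK addrACA.
- exact: lcontinuousB (op_lcontinuous oF) (op_lcontinuous oG).
- by move=> b i h; rewrite FG subrr.
Qed.

End Op.

Section OpClosure.

(** No uniformity in a is asked for, since bounds on the poles are chosen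
    separately for each power of t. *)
Lemma op_local (S S' : countType) (M M' : zmodType) (G : lser S M -> lser S' M') :
    (forall a, exists (S1 : countType) (F : lser S M -> lser S1 M') a', op F /\
       forall v n, laurent v -> G v a n = F v a' n) -> op G.
Proof.
move=> loc; split.
- move=> v w lv lw; apply/funext => a; apply/funext => n.
  have [S1 [F [a' [oF GF]]]] := loc a.
  by rewrite GF ?opB -?[RHS]/(G v a n - G w a n) ?GF //; apply: laurentB.
- move=> p; suff /choice[p' hp'] : forall a, exists k : int,
      forall v, pole_le p v -> forall n, n < - k -> G v a n = 0.
    by exists p' => v pv a n; apply: hp'.
  move=> a; have [S1 [F [a' [[_ bF _] GF]]]] := loc a; have [q qF] := bF p.
  exists (q a') => v pv n nk; rewrite GF; last by exists p.
  exact: qF.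
- move=> p a n; have [S1 [F [a' [[_ _ cF] GF]]]] := loc a.
  have [E EP] := cF p a' n; exists E => v pv vE; rewrite GF; last by exists p.
  exact: EP.
Qed.

(** Covers shifts, derivations and the restriction to t = 0. *)
Lemma op_coef (S S' : countType) (M M' : zmodType) (G : lser S M -> lser S' M') :
    (forall a, exists a' k (c : int -> M -> M'),
       (forall n x y, c n (x - y) = c n x - c n y) /\
       forall v n, G v a n = c n (v a' (n + k))) -> op G.
Proof.
move=> loc; have c0 (c : int -> M -> M') :
    (forall n x y, c n (x - y) = c n x - c n y) -> forall n, c n 0 = 0.
  by move=> cB n; rewrite -(subrr 0) cB subrr.
split.
- move=> v w _ _; apply/funext => a; apply/funext => n.
  have [a' [k [c [cB Gc]]]] := loc a.
  by rewrite Gc -[RHS]/(G v a n - G w a n) !Gc -cB.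
- move=> p; suff /choice[p' hp'] : forall a, exists k : int,
      forall v, pole_le p v -> forall n, n < - k -> G v a n = 0.
    by exists p' => v pv a n; apply: hp'.
  move=> a; have [a' [k [c [cB Gc]]]] := loc a.
  by exists (p a' + k) => v pv n nk; rewrite Gc pv ?c0 //; lia.
- move=> p a n; have [a' [k [c [cB Gc]]]] := loc a.
  exists [fset (a', (n + k)%R)]%fset => v _ /(_ (a', n + k)) vE.
  by rewrite Gc vE ?c0 // in_fset1.
Qed.

Lemma op_comp (S1 S2 S3 : countType) (M1 M2 M3 : zmodType)
    (F : lser S2 M2 -> lser S3 M3) (G : lser S1 M1 -> lser S2 M2) :
  op F -> op G -> op (fun v => F (G v)).
Proof.
move=> oF oG; split.
- by move=> v w lv lw; rewrite (opB oG) // (opB oF) //; apply: op_laurent.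
- move=> p; case: oG => _ /(_ p) [p' hG] _; case: oF => _ /(_ p') [q hF] _.
  by exists q => v pv; apply/hF/hG.
- move=> p a n; case: oG => _ /(_ p) [p' hG] cG; case: oF => _ _ /(_ p' a n) [E EP].
  have /choice[E' EP'] : forall e : mon S2 * int, exists E : {fset mon S1 * int},
      forall v, pole_le p v -> (forall e, e \in E -> v e.1 e.2 = 0) -> G v e.1 e.2 = 0.
    by move=> e; apply: cG.
  exists (\bigcup_(e <- E) E' e)%fset => v pv vE.
  apply: EP => [|e eE]; first exact: hG.
  apply: EP' => // e' e'E; apply: vE; apply/bigfcupP; exists e; rewrite ?eE //.
Qed.

Variables (S S' : countType) (M M' : zmodType).
Implicit Types F G : lser S M -> lser S' M'.

Lemma op_agree F G : op F -> agree F G -> op G.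
Proof.
move=> oF FG; apply: op_local => a; exists S', F, a; split=> // v n lv.
by rewrite FG.
Qed.

Lemma op_id : op (@id (lser S M)).
Proof. by apply: op_coef => a; exists a, 0, (fun=> id); split=> // v n; rewrite addr0. Qed.

Lemma op_sub F G : op F -> op G -> op (fun v => F v - G v).
Proof.
move=> oF oG; split.
- by move=> v w lv lw; rewrite (opB oF) // (opB oG) // !opprD !opprK addrACA.
- move=> p; case: oF => _ /(_ p) [q hF] _; case: oG => _ /(_ p) [q' hG] _.
  exists (fun a => Num.max (q a) (q' a)) => v pv; apply: pole_leB.
    by apply: pole_le_weak (hF v pv) => a; rewrite le_max lexx.
  by apply: pole_le_weak (hG v pv) => a; rewrite le_max lexx orbT.
- move=> p a n; case: oF => _ _ /(_ p a n) [E EP]; case: oG => _ _ /(_ p a n) [E' EP'].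
  exists (E `|` E')%fset => w pw wx.
  rewrite -[LHS]/(F w a n - G w a n) EP ?EP' ?subrr // => e eE; apply: wx.
    by rewrite in_fsetU eE orbT.
  by rewrite in_fsetU eE.
Qed.

Lemma op_cst0 : op (fun _ : lser S M => 0 : lser S' M').
Proof.
apply: op_coef => a; exists (mon1 S), 0, (fun _ _ => 0); split=> // n x y.
by rewrite subrr.
Qed.

Lemma op_add F G : op F -> op G -> op (fun v => F v + G v).
Proof.
move=> oF oG; have := op_sub oF (op_sub op_cst0 oG).
by move=> h; apply: op_agree h _ => v _; rewrite sub0r opprK.
Qed.

Lemma op_sum I (r : seq I) (F : I -> lser S M -> lser S' M') :
  (forall i, op (F i)) -> op (fun v => \sum_(i <- r) F i v).
Proof.
move=> oF; elim: r => [|i r IHr].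
  by apply: op_agree op_cst0 _ => v _; rewrite big_nil.
by apply: op_agree (op_add (oF i) IHr) _ => v _; rewrite big_cons.
Qed.

End OpClosure.

(** * Symbols and multiplication *)

Definition tm (S : countType) (M : zmodType) (s : S) (v : lser S M) : lser S M :=
  fun a n => if a s == 0%N then 0 else v (unvar s a) n.

Definition um (S : countType) (M : zmodType) (i : int) (v : lser S M) : lser S M :=
  fun a n => v a (n - i).

Section Shifts.
Variables (S : countType) (M : zmodType).
Implicit Types (v w : lser S M) (h : M) (s : S) (b : mon S).

Lemma tm_mulvar s v a n : tm s v (mulvar s a) n = v a n.
Proof. by rewrite /tm mulvarE eqxx addn1 mulvarK. Qed.

Lemma op_tm s : op (@tm S M s).
Proof.
apply: op_coef => a; exists (unvar s a), 0, (fun _ x => if a s == 0%N then 0 else x).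
by split=> [n x y|v n]; rewrite /tm ?addr0; case: eqP; rewrite ?subrr.
Qed.

Lemma op_um i : op (@um S M i).
Proof. by apply: op_coef => a; exists a, (- i), (fun _ => id). Qed.

Lemma op_dt s : op (@dt S M s).
Proof.
apply: op_coef => a; exists (mulvar s a), 0, (fun _ x => x *+ (a s).+1).
by split=> [n x y|v n]; rewrite ?mulrnBl // addr0.
Qed.

Lemma op_du : op (@du S M).
Proof.
by apply: op_coef => a; exists a, 1, (fun n x => x *~ (n + 1)); split=> *; rewrite ?mulrzBl.
Qed.

Lemma um0 v : um 0 v = v.
Proof. by apply/funext => a; apply/funext => n; rewrite /um subr0. Qed.

Lemma mono1 i h : mono (mon1 S) i h = um i (csec h).
Proof.
apply/funext => a; apply/funext => n; rewrite /mono /um /csec /emb subr_eq0.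
by case: eqP; case: eqP.
Qed.

Lemma mono_mulvar s b i (h : M) : mono (mulvar s b) i h = tm s (mono b i h).
Proof.
apply/funext => a; apply/funext => n; rewrite /tm; case: eqP => [as0|/eqP as0].
  by rewrite /mono; case: eqP => //= ab; move: as0; rewrite ab mulvarE eqxx addn1.
by rewrite -{1}(unvarK as0) /mono (can_eq (mulvarK s)).
Qed.

Lemma csec_eq (h : M) : (csec h : lser S M) = mono (mon1 S) 0 h.
Proof. by rewrite mono1 um0. Qed.

Lemma laurent_csec (h : M) : laurent (csec h : lser S M).
Proof. by rewrite csec_eq; apply: laurent_mono. Qed.

Lemma csecB h (h' : M) : csec (h - h') = csec h - csec h' :> lser S M.
Proof.
apply/funext => a; apply/funext => n; rewrite -[RHS]/(csec h a n - csec h' a n).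
by rewrite /csec /emb; do 2?case: eqP; rewrite ?subrr.
Qed.

Lemma pole_le_csec p (h : M) : (forall a, 0 <= p a) -> pole_le p (csec h : lser S M).
Proof. by move=> p0; rewrite csec_eq; apply: pole_le_mono; left; have := p0 (mon1 S); lia. Qed.

Lemma laurent_tm s v : laurent v -> laurent (tm s v).
Proof. exact/op_laurent/op_tm. Qed.

Lemma laurent_um i v : laurent v -> laurent (um i v).
Proof. exact/op_laurent/op_um. Qed.

End Shifts.

#[local] Hint Resolve laurent_csec op_tm op_um op_dt op_du : core.

(** Constant sections generate, under multiplication by the variables and by
    powers of u and under limits. *)
Lemma op_eq_gens (S S' : countType) (M M' : zmodType) (F G : lser S M -> lser S' M') :
    op F -> op G ->
    (forall i h, F (um i (csec h)) = G (um i (csec h))) ->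
    (forall s v, laurent v -> F v = G v -> F (tm s v) = G (tm s v)) ->
  agree F G.
Proof.
move=> oF oG FG0 FGS; apply: op_eq_mono => // b i h.
elim/mon_ind: b => [|s b IHb]; first by rewrite mono1 FG0.
by rewrite mono_mulvar; apply: FGS.
Qed.

(** [ext phi] is only well behaved when the poles of the values of phi are
    bounded uniformly. *)
Definition symbol (S : countType) (H H' : zmodType) (q : mon S -> int)
    (phi : H -> lser S H') : Prop :=
  (forall x y, phi (x - y) = phi x - phi y) /\ forall h, pole_le q (phi h).

Definition Zitv (m n : int) : set int := [set i | m <= i <= n].

Lemma finite_Zitv (m n : int) : finite_set (Zitv m n).
Proof.
apply: (@sub_finite_set _ _ ((fun k : nat => m + k%:Z) @` `I_(`|n - m|.+1))).
  by move=> i /= /andP[mi iN]; exists `|i - m|%N => /=; lia.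
exact/finite_image/finite_II.
Qed.

(** A bound valid for all factorizations exists because there are finitely
    many. *)
Lemma factors_bound (S : countType) (p q : mon S -> int) :
  exists r : mon S -> int, forall a e, factors a e -> p e.2 + q e.1 <= r a.
Proof.
suff /choice[r rP] : forall a, exists k, forall e, factors a e -> p e.2 + q e.1 <= k.
  by exists r.
move=> a; exists (\sum_(e <- fset_set (factors a)) `|p e.2 + q e.1|) => e fe.
rewrite (big_fsetD1 e) /=; last by rewrite in_fset_set ?inE //; apply: finite_factors.
rewrite (le_trans (ler_norm _)) // lerDl sumr_ge0 //.
Qed.

Section Ext.
Variables (S : countType) (H H' : zmodType) (q : mon S -> int).
Variables (phi : H -> lser S H') (sphi : symbol q phi).

Let phi0 : phi 0 = 0.
Proof. by rewrite -(subrr 0) sphi.1 subrr. Qed.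

Let phi0E b j : phi 0 b j = 0.
Proof. by rewrite phi0. Qed.

(** Bounds on the poles make both sums of the definition of [ext] finite. *)
Lemma ext_big p v a n : pole_le p v ->
  ext phi v a n = \sum_(e <- fset_set (factors a))
    \sum_(i <- fset_set (Zitv (- p e.2) (n + q e.1))) phi (v e.2 i) e.1 (n - i).
Proof.
move=> pv; rewrite /ext fsbig_finite; last exact: finite_factors.
apply: eq_bigr => e _; rewrite -fsbig_finite; last exact: finite_Zitv.
symmetry; apply: fsbig_widen => // i [_ /= /negP]; rewrite negb_and -!ltNge.
case/orP=> h; first by rewrite pv.
by apply: sphi.2; rewrite ltrBlDr addrC ltrBrDr.
Qed.

Lemma pole_le_ext p r v : (forall a e, factors a e -> p e.2 + q e.1 <= r a) ->
  pole_le p v -> pole_le r (ext phi v).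
Proof.
move=> pqr pv a n an; rewrite /ext fsbig1 // => e fe; rewrite fsbig1 // => i _.
have := pqr _ _ fe; case: (ltP i (- p e.2)) => [ip|pi] h; first by rewrite pv.
have bound (P Q k j A : int) : P + Q <= A -> - P <= j -> k < - A -> k - j < - Q by lia.
by apply: sphi.2; apply: bound h pi an.
Qed.

Lemma op_of_symbol : op (ext phi).
Proof.
split.
- move=> v w lv lw; have [p pv pw] := laurent_common lv lw.
  apply/funext => a; apply/funext => n.
  rewrite -[RHS]/(ext phi v a n - ext phi w a n) !(@ext_big p) //; last exact: pole_leB.
  rewrite -sumrB; apply: eq_bigr => e _; rewrite -sumrB; apply: eq_bigr => i _.
  by rewrite -[(v - w) _ _]/(v e.2 i - w e.2 i) sphi.1.
- by move=> p; have [r pqr] := factors_bound p q; exists r => v; apply: pole_le_ext.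
- move=> p a n.
  exists (\bigcup_(e <- fset_set (factors a))
     [fset (e.2, i) | i in fset_set (Zitv (- p e.2) (n + q e.1)%R)])%fset.
  move=> v pv vE; rewrite (ext_big _ _ pv) big_seq big1 // => e ea.
  rewrite big_seq big1 // => i ie; rewrite (vE (e.2, i)) ?phi0E //.
  by apply/bigfcupP; exists e; rewrite ?ea //; apply/imfsetP; exists i.
Qed.

Lemma ext_tm s v : ext phi (tm s v) = tm s (ext phi v).
Proof.
apply/funext => a; apply/funext => n; rewrite {2}/tm; case: eqP => [as0|/eqP as0].
  rewrite /ext fsbig1 // => e fe; rewrite fsbig1 // => i _.
  by rewrite /tm (factors_eq0 fe as0) phi0E.
rewrite -{1}(unvarK as0); set b := unvar s a; rewrite /ext.
pose h (e : mon S * mon S) := (e.1, mulvar s e.2).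
transitivity (\sum_(e \in h @` factors b) \sum_(i \in [set: int])
    phi (tm s v e.2 i) e.1 (n - i)).
  symmetry; apply: fsbig_widen => [_ [e fe <-]|e [fe ne]].
    exact: factors_mulvar.
  rewrite /= fsbig1 // => i _; rewrite /tm; case: eqP => // /eqP es0.
  by case: ne; exists (e.1, unvar s e.2); [exact: factors_unvar fe (elimN eqP es0)
    |rewrite /h /= unvarK // -surjective_pairing].
rewrite fsbig_image; last first.
  move=> e e' _ _ [e1 /(can_inj (mulvarK s)) e2].
  by rewrite (surjective_pairing e) e1 e2 -surjective_pairing.
by apply: eq_fsbigr => e _; apply: eq_fsbigr => i _; rewrite tm_mulvar.
Qed.

Lemma ext_um k v : ext phi (um k v) = um k (ext phi v).
Proof.
apply/funext => a; apply/funext => n; rewrite {2}/um /ext.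
apply: eq_fsbigr => e _; rewrite (@reindex_fsbigT _ _ _ _ _ (fun i => i + k)).
  by apply: eq_fsbigr => i _; rewrite /um addrK [i + k]addrC opprD addrA.
by exists (fun i => i - k) => i; rewrite ?addrK ?subrK.
Qed.

(** Only the factorization of t^a as t^a times 1, and the power u^0, contribute. *)
Lemma ext_csec h : ext phi (csec h) = phi h.
Proof.
apply/funext => a; apply/funext => n; rewrite /ext.
transitivity (\sum_(e \in [set (a, mon1 S)]) \sum_(i \in [set: int])
    phi (csec h e.2 i) e.1 (n - i)).
  symmetry; apply: fsbig_widen => [_ ->|e [fe ne]].
    by have /factors_swap := factors_1l a.
  rewrite /= fsbig1 // => i _; rewrite /csec /emb; case: eqP => // _; case: eqP => // e2.
  case: ne; rewrite (surjective_pairing e) e2; congr pair.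
  exact: (factors_eq1 (factors_swap fe)).
rewrite fsbig_set1 /= -(fsbig_widen [set 0]) //.
  by rewrite fsbig_set1 /csec /emb !eqxx subr0.
by move=> i [_ i0]; rewrite /= /csec /emb; case: eqP => // /i0.
Qed.

End Ext.

Lemma ext_local (S : countType) (H H' : zmodType) (phi : H -> lser S H') v w a :
  (forall e, factors a e -> v e.2 = w e.2) -> ext phi v a = ext phi w a.
Proof.
move=> vw; apply/funext => n; rewrite /ext; apply: eq_fsbigr => e.
by rewrite inE => /vw ->.
Qed.

Lemma symbol_op (S S' : countType) (H H' : zmodType) (F : lser S H -> lser S' H') q :
  op F -> (forall h, pole_le q (F (csec h))) -> symbol q (fun h => F (csec h)).
Proof. by move=> oF pF; split=> // x y; rewrite csecB opB. Qed.

Section Lmul.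
Variables (S : countType) (R : comPzRingType) (H : lmodType R).
Implicit Types (g : lser S R) (v : lser S H).

(** Multiplication is bilinear, hence also an extension of a symbol in its first
    argument. This gives continuity in both arguments. *)
Lemma lmul_swap g v : lmul g v = ext (fun (r : R) b j => r *: v b j) g.
Proof.
apply/funext => a; apply/funext => n; rewrite /lmul /ext.
rewrite (@reindex_fsbig _ _ _ _ _ (fun e : mon S * mon S => (e.2, e.1)) (factors a)).
  apply: eq_fsbigr => e _; rewrite (@reindex_fsbigT _ _ _ _ _ (fun i : int => n - i)).
    by apply: eq_fsbigr => i _; rewrite opprB addrC subrK.
  by exists (fun i : int => n - i) => i; rewrite opprB addrC subrK.
split=> [e|[b c] [b' c'] _ _ [-> ->] //|e fe]; first exact: factors_swap.
by exists (e.2, e.1); [exact: factors_swap|rewrite -surjective_pairing].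
Qed.

Lemma symbol_lmul q g : pole_le q g -> symbol q (fun (h : H) b j => g b j *: h).
Proof.
move=> qg; split=> [x y|h a n an]; last by rewrite qg // scale0r.
by apply/funext => a; apply/funext => n; rewrite scalerBr.
Qed.

Lemma symbol_lmul_l q v : pole_le q v -> symbol q (fun (r : R) b j => r *: v b j).
Proof.
move=> qv; split=> [x y|h a n an]; last by rewrite qv // scaler0.
by apply/funext => a; apply/funext => n; rewrite scalerBl.
Qed.

Lemma op_lmul g : laurent g -> op (fun v => lmul g v).
Proof. by move=> [q /symbol_lmul sg]; apply: op_of_symbol sg. Qed.

Lemma op_lmul_l v : laurent v -> op (fun g => lmul g v).
Proof.
move=> [q /symbol_lmul_l sv]; apply: op_agree (op_of_symbol sv) _ => g _.
by rewrite lmul_swap.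
Qed.

Lemma laurent_lmul g v : laurent g -> laurent v -> laurent (lmul g v).
Proof. by move=> lg lv; apply: op_laurent lv; apply: op_lmul. Qed.

Lemma lmul_tm g s v : laurent g -> lmul g (tm s v) = tm s (lmul g v).
Proof. by move=> [q /symbol_lmul sg]; apply: ext_tm sg _ _. Qed.

Lemma lmul_um g i v : laurent g -> lmul g (um i v) = um i (lmul g v).
Proof. by move=> [q /symbol_lmul sg]; apply: ext_um. Qed.

Lemma tm_lmul g s v : laurent v -> lmul (tm s g) v = tm s (lmul g v).
Proof. by move=> [q /symbol_lmul_l sv]; rewrite !lmul_swap; apply: ext_tm sv _ _. Qed.

Lemma um_lmul g i v : lmul (um i g) v = um i (lmul g v).
Proof. by rewrite !lmul_swap; apply: ext_um. Qed.

Lemma csec_lmul r v : laurent v -> lmul (csec r) v = r *: v.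
Proof. by move=> [q /symbol_lmul_l sv]; rewrite lmul_swap (ext_csec sv). Qed.

Lemma csec1_lmul v : laurent v -> lmul (csec 1) v = v.
Proof. by move=> lv; rewrite csec_lmul // scale1r. Qed.

Lemma op_scale r : op (fun v : lser S H => r *: v).
Proof.
apply: op_coef => a; exists a, 0, (fun _ x => r *: x).
by split=> [n x y|v n]; rewrite ?scalerBr // addr0.
Qed.

Lemma laurentZ r v : laurent v -> laurent (r *: v).
Proof. exact/op_laurent/op_scale. Qed.

Lemma scale_tm r s v : r *: tm s v = tm s (r *: v).
Proof.
apply/funext => a; apply/funext => n; rewrite -[LHS]/(r *: tm s v a n) /tm.
by case: eqP => // _; rewrite scaler0.
Qed.

Lemma scale_um r i v : r *: um i v = um i (r *: v).
Proof. by []. Qed.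

End Lmul.

#[local] Hint Resolve op_scale : core.

(** * Linear maps, connections and their symbols *)

(** Linearity over R((u))[[t]] tested on the generators t_s and u^i; continuity
    gives the rest in [commutes_tu_linear]. *)
Definition commutes_tu (S : countType) (H H' : zmodType)
    (F : lser S H -> lser S H') : Prop :=
  (forall s v, laurent v -> F (tm s v) = tm s (F v)) /\
  (forall i v, laurent v -> F (um i v) = um i (F v)).

Definition scalable_on (S S' : countType) (R : comPzRingType) (H H' : lmodType R)
    (F : lser S H -> lser S' H') : Prop :=
  forall r v, laurent v -> F (r *: v) = r *: F v.

Lemma rlinearB (S S' : countType) (R : comPzRingType) (H H' : lmodType R)
    (F : lser S H -> lser S' H') : rlinear F ->
  forall v w, laurent v -> laurent w -> F (v - w) = F v - F w.
Proof.
move=> lF v w lv lw; have := lF (-1) w v lw lv.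
rewrite -[F _]/(F (-1 *: w + v)) -[RHS]/(-1 *: F w + F v).
by rewrite !scaleN1r addrC => ->; rewrite addrC.
Qed.

Lemma rlinearZ (S S' : countType) (R : comPzRingType) (H H' : lmodType R)
    (F : lser S H -> lser S' H') : rlinear F -> scalable_on F.
Proof.
move=> lF r v lv; have F0 : F 0 = 0 by rewrite -(subrr 0) (rlinearB lF) // subrr.
have := lF r v 0 lv (laurent0 _ _).
by rewrite -[F _]/(F (r *: v + 0)) -[RHS]/(r *: F v + F 0) F0 !addr0.
Qed.

Lemma rlinear_op (S S' : countType) (R : comPzRingType) (H H' : lmodType R)
    (F : lser S H -> lser S' H') : op F -> scalable_on F -> rlinear F.
Proof.
move=> oF FZ r v w lv lw; rewrite -[LHS]/(F (r *: v + w)).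
by rewrite (opD oF) ?FZ //; apply: laurentZ.
Qed.

Section Derivations.
Variables (S : countType).

Section Zmodule.
Variable M : zmodType.
Implicit Types (v w : lser S M).

Lemma dt_tm r s v : dt r (tm s v) = (if r == s then v else 0) + tm s (dt r v).
Proof.
apply/funext => a; apply/funext => n.
rewrite -[RHS]/((if r == s then v else 0) a n + tm s (dt r v) a n) /dt.
case: (r =P s) => [<-|/eqP rs].
  rewrite tm_mulvar /tm mulrS; congr (_ + _).
  case: eqP => [->|/eqP ar]; first by rewrite mulr0n.
  by rewrite unvarK // unvarE eqxx subn1 prednK // lt0n.
rewrite add0r /tm mulvarE [s == r]eq_sym (negPf rs) addn0.
case: eqP => _; first by rewrite mul0rn.
by rewrite unvar_mulvar // unvarE (negPf rs) subn0.
Qed.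

Lemma dt_um r i v : dt r (um i v) = um i (dt r v).
Proof. by []. Qed.

Lemma dt_csec r (h : M) : dt r (csec h) = 0 :> lser S M.
Proof.
apply/funext => a; apply/funext => n; rewrite /dt /csec /emb.
by case: eqP => _; [case: eqP => [/mulvar_neq1 //|_]|]; exact: mul0rn.
Qed.

Lemma du_tm s v : du (tm s v) = tm s (du v).
Proof.
apply/funext => a; apply/funext => n; rewrite /du /tm.
by case: eqP => // _; rewrite mul0rz.
Qed.

Definition mulz i v : lser S M := fun a n => v a n *~ i.

Lemma du_um i v : du (um i v) = mulz i (um (i - 1) v) + um i (du v).
Proof.
apply/funext => a; apply/funext => n.
rewrite -[RHS]/(v a (n - (i - 1)) *~ i + v a (n - i + 1) *~ (n - i + 1)).
have -> : n - (i - 1) = n + 1 - i by lia.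
have -> : n - i + 1 = n + 1 - i by lia.
by rewrite -mulrzDr /du /um; congr (_ *~ _); lia.
Qed.

Lemma du_csec (h : M) : du (csec h) = 0 :> lser S M.
Proof.
apply/funext => a; apply/funext => n; rewrite /du /csec /emb.
by case: eqP => [->|_]; rewrite ?mulr0z ?mul0rz.
Qed.

Lemma mulz_csec i (h : M) : mulz i (csec h) = csec (h *~ i).
Proof.
apply/funext => a; apply/funext => n; rewrite /mulz /csec /emb.
by do 2?case: eqP => _; rewrite ?mul0rz.
Qed.

End Zmodule.

Variables (R : comPzRingType) (H : lmodType R).
Implicit Types (g : lser S R) (v w : lser S H).

Lemma dtZ r (c : R) v : dt r (c *: v) = c *: dt r v.
Proof.
apply/funext => a; apply/funext => n.
by rewrite -[RHS]/(c *: (v (mulvar r a) n *+ (a r).+1)) -scalerMnr.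
Qed.

Lemma mulzE i v : mulz i v = i%:~R *: v.
Proof.
apply/funext => a; apply/funext => n.
by rewrite -[RHS]/(i%:~R *: v a n) scaler_int.
Qed.

Lemma duZ (c : R) v : du (c *: v) = c *: du v.
Proof.
apply/funext => a; apply/funext => n.
by rewrite -[RHS]/(c *: (v a (n + 1) *~ (n + 1))) -scalerMzr.
Qed.

(** The data of a derivation of the ring of series together with its
    extension to H-valued series that kills constant sections. *)
Definition derivation (d : lser S R -> lser S R) (dH : lser S H -> lser S H) : Prop :=
  [/\ op d, op dH, scalable_on dH, forall h, dH (csec h) = 0
    & forall g v, laurent g -> laurent v ->
        dH (lmul g v) = lmul (d g) v + lmul g (dH v)].

Lemma derivation_dt s : derivation (@dt S R s) (@dt S H s).
Proof.
split=> //; [by move=> r v lv; apply: dtZ|exact: dt_csec|move=> g v lg lv].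
have ldv := op_laurent (op_dt _ s) lv.
apply: (op_eq_gens (F := fun g => dt s (lmul g v))
          (G := fun g => lmul (dt s g) v + lmul g (dt s v))) lg => {g}.
- exact: op_comp (op_dt _ s) (op_lmul_l lv).
- exact: op_add (op_comp (op_lmul_l lv) (op_dt _ s)) (op_lmul_l ldv).
- move=> i r; rewrite dt_um !um_lmul !csec_lmul // dt_um dtZ dt_csec.
  by rewrite (op0 (op_lmul_l lv)) (op0 (op_um _ _ _)) add0r.
- move=> r g lg IH; have ldg := op_laurent (op_dt _ s) lg.
  have lif : laurent (if s == r then g else 0) by case: (s == r).
  rewrite !tm_lmul // !dt_tm IH (opD (op_lmul_l lv) lif (laurent_tm r ldg)) tm_lmul //.
  rewrite (opD (op_tm _ r)); [|exact: laurent_lmul..].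
  rewrite addrA; congr (_ + _ + _).
  by case: (s == r); rewrite ?(op0 (op_lmul_l lv)).
Qed.

Lemma derivation_du : derivation (@du S R) (@du S H).
Proof.
split=> //; [by move=> r v lv; apply: duZ|exact: du_csec|move=> g v lg lv].
have ldv := op_laurent (op_du _ _) lv.
apply: (op_eq_gens (F := fun g => du (lmul g v))
          (G := fun g => lmul (du g) v + lmul g (du v))) lg => {g}.
- exact: op_comp (op_du _ _) (op_lmul_l lv).
- exact: op_add (op_comp (op_lmul_l lv) (op_du _ _)) (op_lmul_l ldv).
- move=> i r; rewrite !du_um du_csec (op0 (op_um _ _ _)) addr0.
  rewrite -[mulz i _]/(um (i - 1) (mulz i _)) mulz_csec !um_lmul !csec_lmul // du_um duZ; congr (_ + _).
  rewrite -[mulz i _]/(um (i - 1) (mulz i _)) mulzE; congr um.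
  by rewrite scalerA; congr (_ *: v); rewrite mulrzl.
- move=> r g lg IH; have ldg := op_laurent (op_du _ _) lg.
  by rewrite !tm_lmul // !du_tm IH tm_lmul // (opD (op_tm _ r)) //; exact: laurent_lmul.
Qed.

End Derivations.

Section Representation.
Variables (S : countType) (R : comPzRingType) (H H' : lmodType R).

Lemma commutes_tu_linear (F : lser S H -> lser S H') :
    op F -> scalable_on F -> commutes_tu F ->
  forall g v, laurent g -> laurent v -> F (lmul g v) = lmul g (F v).
Proof.
move=> oF FZ [Ft Fu] g v lg lv; have lFv := op_laurent oF lv.
apply: (op_eq_gens (F := fun g => F (lmul g v)) (G := fun g => lmul g (F v))) lg.
- exact: op_comp oF (op_lmul_l lv).
- exact: op_lmul_l.
- by move=> i r; rewrite !um_lmul !csec_lmul // Fu ?FZ //; apply: laurentZ.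
- by move=> s {}g lg IH; rewrite !tm_lmul // Ft ?IH //; apply: laurent_lmul.
Qed.

Lemma linear_commutes_tu (F : lser S H -> lser S H') :
    (forall v, laurent v -> laurent (F v)) ->
    (forall g v, laurent g -> laurent v -> F (lmul g v) = lmul g (F v)) ->
  commutes_tu F.
Proof.
move=> lF Fl; split=> [s|i] v lv; have lFv := lF v lv.
  have := Fl (tm s (csec 1)) v; rewrite !tm_lmul // !csec1_lmul //.
  by apply=> //; apply: laurent_tm.
have := Fl (um i (csec 1)) v; rewrite !um_lmul // !csec1_lmul //.
by apply=> //; apply: laurent_um.
Qed.

Lemma commutes_tu_ext q (phi : H -> lser S H') : symbol q phi -> commutes_tu (ext phi).
Proof. by move=> sphi; split=> *; rewrite ?(ext_tm sphi) ?ext_um. Qed.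

(** A continuous linear map is determined by its values on constant sections;
    this makes it an operator, because only the poles of these values have to
    be bounded. *)
Lemma symbol_rep q (F : lser S H -> lser S H') :
    (forall v w, laurent v -> laurent w -> F (v - w) = F v - F w) ->
    lcontinuous F -> commutes_tu F -> (forall h, pole_le q (F (csec h))) ->
  symbol q (fun h => F (csec h)) /\ agree F (ext (fun h => F (csec h))).
Proof.
move=> FB cF [Ft Fu] pF; have sF : symbol q (fun h => F (csec h)).
  by split=> // x y; rewrite csecB FB.
split=> // v lv; have oE := op_of_symbol sF.
apply/eqP; rewrite -subr_eq0; apply/eqP.
apply: (@eq0_of_mono _ _ _ _ (fun v => F v - ext (fun h => F (csec h)) v)) => //.
- by move=> x y lx ly; rewrite FB // (opB oE) // !opprD !opprK addrACA.
- exact: lcontinuousB cF (op_lcontinuous oE).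
- move=> b i h; apply/eqP; rewrite subr_eq0; apply/eqP.
  elim/mon_ind: b => [|s b IHb]; first by rewrite mono1 Fu // ext_um (ext_csec sF).
  by rewrite mono_mulvar Ft // (ext_tm sF) IHb.
Qed.

Lemma linear_map_rep (F : lser S H -> lser S H') : is_linear_map F ->
  symbol (fun=> 0) (fun h => F (csec h)) /\ agree F (ext (fun h => F (csec h))).
Proof.
move=> [lF rF Fl pF cF]; apply: symbol_rep => //; first exact: rlinearB.
  exact: linear_commutes_tu.
by move=> h; apply/pF/pole_le_csec.
Qed.

Lemma op_linear_map (F : lser S H -> lser S H') : is_linear_map F -> op F.
Proof.
move=> /linear_map_rep [sF Fext]; apply: op_agree (op_of_symbol sF) _ => v lv.
by rewrite Fext.
Qed.

Lemma linear_map_tu (F : lser S H -> lser S H') : is_linear_map F -> commutes_tu F.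
Proof. by case=> lF rF Fl pF cF; apply: linear_commutes_tu. Qed.

Lemma linear_map_of_tu (F : lser S H -> lser S H') :
    op F -> scalable_on F -> commutes_tu F ->
    (forall v, pole_le (fun=> 0) v -> pole_le (fun=> 0) (F v)) ->
  is_linear_map F.
Proof.
move=> oF FZ Ftu pF; split=> //.
- by move=> v; apply: op_laurent.
- exact: rlinear_op.
- exact: commutes_tu_linear.
- exact: op_lcontinuous.
Qed.

End Representation.

Section Connections.
Variables (S : countType) (R : comPzRingType) (H : lmodType R).
Variables (d : lser S R -> lser S R) (dH : lser S H -> lser S H).
Hypothesis (der : derivation d dH).

(** A connection minus the derivation it lies over is linear. *)
Lemma conn_rep p (N : lser S H -> lser S H) : is_conn d p N ->
  symbol p (fun h => N (csec h)) /\
  agree N (fun v => dH v + ext (fun h => N (csec h)) v).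
Proof.
case: der => od odH dHZ dH0 dHl [lN rN Nl pN cN].
pose L v := N v - dH v.
have lL v : laurent v -> laurent (L v).
  by move=> lv; apply: laurentB; [exact: lN|exact: op_laurent odH lv].
have [] := @symbol_rep _ _ _ _ p L.
- move=> v w lv lw; rewrite /L (rlinearB rN) // (opB odH) //.
  by rewrite !opprD !opprK addrACA.
- exact: lcontinuousB cN (op_lcontinuous odH).
- apply: linear_commutes_tu => // g v lg lv.
  rewrite /L dHl // -[N _]/(N (lmul g v)) Nl //.
  rewrite -[X in X - _]/(lmul (d g) v + lmul g (N v)).
  rewrite opprD addrACA subrr add0r (opB (op_lmul _ lg)) //.
    exact: lN.
  exact: op_laurent odH lv.
- by move=> h; rewrite /L dH0 subr0; apply/pN/pole_le_csec.
have -> : (fun h => L (csec h)) = (fun h => N (csec h)).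
  by apply/funext => h; rewrite /L dH0 subr0.
by move=> sN LE; split=> // v lv; rewrite -LE // /L addrC subrK.
Qed.

Lemma op_conn p (N : lser S H -> lser S H) : is_conn d p N -> op N.
Proof.
case: (der) => _ odH _ _ _ /conn_rep [sN NE].
apply: op_agree (op_add odH (op_of_symbol sN)) _ => v lv.
by rewrite NE.
Qed.

(** Conversely, the Leibniz rule has to be checked on t_s and u^i only. *)
Lemma conn_of_tu p (N : lser S H -> lser S H) :
    op N -> scalable_on N -> commutes_tu (fun v => N v - dH v) ->
    (forall v, pole_le (fun=> 0) v -> pole_le p (N v)) ->
  is_conn d p N.
Proof.
case: der => od odH dHZ dH0 dHl oN NZ Ntu pN; split=> //.
- by move=> v; apply: op_laurent.
- exact: rlinear_op.
- move=> g v lg lv; rewrite -[RHS]/(lmul (d g) v + lmul g (N v)).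
  have lNv := op_laurent oN lv; have ldv := op_laurent odH lv.
  have LZ : scalable_on (fun v => N v - dH v).
    by move=> r w lw; rewrite NZ // dHZ // -scalerBr.
  have := commutes_tu_linear (op_sub oN odH) LZ Ntu lg lv.
  rewrite (opB (op_lmul _ lg)) // dHl //.
  by move=> /eqP; rewrite opprD addrA subr_eq subrK subr_eq addrC => /eqP.
- exact: op_lcontinuous.
Qed.

End Connections.

(** * Restriction to t = 0 *)

Section Restriction.
Variables (S : countType).

Lemma mon_void (a : mon void) : a = mon1 void.
Proof. by apply/fsfunP => -[]. Qed.

Lemma op_at0 (M : zmodType) : op (@at0 S M).
Proof.
by apply: op_coef => a; exists (mon1 S), 0, (fun=> id); split=> // v n; rewrite addr0.
Qed.

Lemma op_lift0 (M : zmodType) : op (@Defs.lift0 S M).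
Proof.
apply: op_coef => a.
exists (mon1 void), 0, (fun _ x => if a == mon1 S then x else 0).
by split=> [n x y|v n]; rewrite /Defs.lift0 ?addr0; case: eqP; rewrite ?subr0.
Qed.

Lemma at0_lift0 (M : zmodType) (w : lser void M) : at0 (Defs.lift0 w : lser S M) = w.
Proof.
by apply/funext => a; apply/funext => n; rewrite /at0 /Defs.lift0 eqxx (mon_void a).
Qed.

Lemma op_restr (M M' : zmodType) (F : lser S M -> lser S M') : op F -> op (restr F).
Proof. by move=> oF; apply: op_comp (op_at0 _) (op_comp oF (op_lift0 _)). Qed.

(** This makes F v at t = 0 depend only on v at t = 0, and lets F be applied term
    by term to locally finite sums. *)
Definition tlocal (M M' : zmodType) (F : lser S M -> lser S M') : Prop :=
  forall a v w, laurent v -> laurent w ->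
    (forall e, factors a e -> v e.2 = w e.2) -> F v a = F w a.

Lemma at0_tlocal (M M' : zmodType) (F : lser S M -> lser S M') v :
  tlocal F -> laurent v -> at0 (F v) = restr F (at0 v).
Proof.
move=> locF lv; apply/funext => a; apply/funext => n; rewrite /restr /at0.
rewrite (locF _ v (Defs.lift0 (at0 v))) //.
  exact/(op_laurent (op_lift0 _))/(op_laurent (op_at0 _)).
by move=> e; rewrite factors1 => -> /=; rewrite /Defs.lift0 eqxx.
Qed.

(** The middle lift may be dropped since F only sees the value at t = 0. *)
Lemma restr_comp (M1 M2 M3 : zmodType) (F : lser S M2 -> lser S M3)
    (G : lser S M1 -> lser S M2) w :
  tlocal F -> op G -> laurent w -> restr F (restr G w) = at0 (F (G (Defs.lift0 w))).
Proof.
move=> lF oG lw; rewrite (at0_tlocal lF) //.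
exact/(op_laurent oG)/(op_laurent (op_lift0 _)).
Qed.

Variable R : comPzRingType.

Lemma tlocal_linear_map (H H' : lmodType R) (F : lser S H -> lser S H') :
  is_linear_map F -> tlocal F.
Proof.
move=> /linear_map_rep [_ FE] a v w lv lw vw; rewrite !FE //.
exact: ext_local.
Qed.

Lemma tlocal_conn_du (H : lmodType R) p (N : lser S H -> lser S H) :
  is_conn (@du S R) p N -> tlocal N.
Proof.
move=> /(conn_rep (derivation_du S H)) [_ NE] a v w lv lw vw; rewrite !NE //.
rewrite -[LHS]/(du v a + ext _ v a) -[RHS]/(du w a + ext _ w a).
rewrite (ext_local _ vw); congr (_ + _); apply/funext => n.
by rewrite /du (vw _ (factors_1l a)).
Qed.

End Restriction.

(** * Uniqueness of horizontal maps *)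

(** The form d/dt_s + A of a connection, all that the induction on the degree in
    t uses. It also applies to d/dt_s itself. *)
Definition is_dt_conn (S : countType) (H : zmodType) (s : S)
    (N : lser S H -> lser S H) : Prop :=
  exists (q : mon S -> int) (phi : H -> lser S H),
    symbol q phi /\ agree N (fun v => dt s v + ext phi v).

Lemma conn_is_dt (S : countType) (R : comPzRingType) (H : lmodType R) (s : S) p
    (N : lser S H -> lser S H) : is_conn (@dt S R s) p N -> is_dt_conn s N.
Proof. by move=> /(conn_rep (derivation_dt H s)) h; exists p, (fun h => N (csec h)). Qed.

Lemma dt_is_dt_conn (S : countType) (H : zmodType) (s : S) : is_dt_conn s (@dt S H s).
Proof.
have s0 : symbol (fun=> 0) (fun _ : H => 0 : lser S H) by split=> // x y; rewrite subrr.
exists (fun=> 0), (fun _ => 0); split=> // v lv.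
rewrite (_ : ext _ v = 0) ?addr0 //; apply/funext => a; apply/funext => n.
by rewrite /ext fsbig1 // => e _; rewrite fsbig1.
Qed.

Lemma op_dt_conn (S : countType) (H : zmodType) (s : S) (N : lser S H -> lser S H) :
  is_dt_conn s N -> op N.
Proof.
move=> [q [phi [sphi NE]]]; apply: op_agree (op_add (op_dt _ s) (op_of_symbol sphi)) _.
by move=> v lv; rewrite NE.
Qed.

Lemma dt_conn_tm (S : countType) (H : zmodType) (r s : S) (N : lser S H -> lser S H) v :
  is_dt_conn r N -> laurent v ->
  N (tm s v) = (if r == s then v else 0) + tm s (N v).
Proof.
move=> [q [phi [sphi NE]]] lv; rewrite !NE //; last exact: laurent_tm.
rewrite dt_tm (ext_tm sphi) (opD (op_tm _ s)) ?addrA //.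
  exact: op_laurent (op_dt _ r) lv.
exact: op_laurent (op_of_symbol sphi) lv.
Qed.

Lemma dt_conn_um (S : countType) (H : zmodType) (r : S) (N : lser S H -> lser S H) i v :
  is_dt_conn r N -> laurent v -> N (um i v) = um i (N v).
Proof.
move=> [q [phi [sphi NE]]] lv; rewrite !NE //; last exact: laurent_um.
by rewrite ext_um.
Qed.

(** If N2 E = E N1, the equation N2_s (E v) = E (N1_s v) gives the coefficient
    of t^a t_s in E v from coefficients of degree at most |a| of E v and of
    E (N1_s v). So the whole family of the E v vanishes by induction on the
    degree. *)
Lemma intertwiner_eq0 (S : countType) (H H' : zmodType)
    (tf : forall n (x : H'), x *+ n.+1 = 0 -> x = 0)
    (N1 : S -> lser S H -> lser S H) (N2 : S -> lser S H' -> lser S H')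
    (E : lser S H -> lser S H') :
    (forall s v, laurent v -> laurent (N1 s v)) ->
    (forall s, is_dt_conn s (N2 s)) ->
    (forall v, laurent v -> laurent (E v)) ->
    (forall s v, laurent v -> N2 s (E v) = E (N1 s v)) ->
    (forall v, laurent v -> at0 (E v) = 0) ->
  forall v, laurent v -> E v = 0.
Proof.
move=> lN1 dN2 lE EN E0 v lv; apply/funext => a.
have [d] := ubnP (mdeg a); elim: d => // d IHd in v lv a *.
case: (mon_cases a) => [-> _|[s [b ->]]].
  by apply/funext => n; have := congr1 (fun w : lser void H' => w (mon1 void) n) (E0 v lv).
rewrite mdeg_mulvar ltnS => bd; apply/funext => n; apply: (@tf (b s)).
have [q [phi [sphi N2E]]] := dN2 s.
have := congr1 (fun w => w b n) (EN s v lv); rewrite IHd //; last exact: lN1.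
rewrite N2E; last exact: lE.
rewrite -[LHS]/(E v (mulvar s b) n *+ (b s).+1 + ext phi (E v) b n).
rewrite (@ext_local _ _ _ phi (E v) 0) ?(op0 (op_of_symbol sphi)) ?addr0 // => e fe.
by apply: IHd => //; have := mdeg_factors fe; move: bd; lia.
Qed.

(** * Inversion of linear maps that are invertible at t = 0 *)

Section Neumann.
Variables (S : countType) (M : zmodType) (K : lser S M -> lser S M).
Hypothesis opK : op K.

Definition vanishes_below d (v : lser S M) : Prop := forall a, (mdeg a < d)%N -> v a = 0.

Hypothesis Kraise : forall d v, laurent v -> vanishes_below d v -> vanishes_below d.+1 (K v).

(** The series 1 + K + K^2 + ..., cut off where its terms vanish: K^k v has no
    coefficient of degree less than k. *)
Definition neumann (v : lser S M) : lser S M :=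
  fun a n => \sum_(k < (mdeg a).+1) iter k K v a n.

Lemma op_iter k : op (fun v => iter k K v).
Proof. by elim: k => [|k IHk]; [exact: op_id|exact: op_comp opK IHk]. Qed.

Let laurent_iter k v : laurent v -> laurent (iter k K v).
Proof. exact/op_laurent/op_iter. Qed.

Lemma iter_vanishes_below k v : laurent v -> vanishes_below k (iter k K v).
Proof.
by move=> lv; elim: k => // k IHk; apply: Kraise => //; apply: laurent_iter.
Qed.

Lemma neumann_trunc m v a : laurent v -> (mdeg a < m)%N ->
  neumann v a = (\sum_(k < m) iter k K v) a.
Proof.
move=> lv am; apply/funext => n; rewrite /neumann !fct_sumE.
rewrite -!(big_mkord xpredT (fun k => iter k K v a n)) (big_cat_nat _ am) //=.
rewrite [X in _ = _ + X]big_nat [X in _ = _ + X]big1 ?addr0 // => k /andP[ak _].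
by rewrite (iter_vanishes_below lv).
Qed.

Lemma op_neumann : op neumann.
Proof.
apply: op_local => a; exists S, (fun v => \sum_(k <- iota 0 (mdeg a).+1) iter k K v), a.
split=> [|v n lv]; first by apply: op_sum => k; apply: op_iter.
by rewrite (neumann_trunc lv (ltnSn _)) -(big_mkord xpredT (fun k => iter k K v)).
Qed.

Lemma pole_le_neumann p v : (forall w, pole_le p w -> pole_le p (K w)) ->
  pole_le p v -> pole_le p (neumann v).
Proof.
move=> pK pv a n an; rewrite /neumann big1 // => k _.
suff pk m : pole_le p (iter m K v) by apply: pk.
by elim: m => // m IHm; apply: pK.
Qed.

Lemma neumannK v : laurent v -> neumann v - K (neumann v) = v.
Proof.
move=> lv; apply/eqP; rewrite subr_eq; apply/eqP/funext => a.
have lG := op_laurent op_neumann lv.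
have lsum m : laurent (\sum_(k < m) iter k K v).
  by apply: laurent_sum => k; apply: laurent_iter.
have KG : K (neumann v) a = K (\sum_(k < mdeg a) iter k K v) a.
  apply/eqP; rewrite -subr_eq0; apply/eqP.
  rewrite -[LHS]/((K (neumann v) - K (\sum_(k < mdeg a) iter k K v)) a) -(opB opK) //.
  apply: (Kraise (d := mdeg a)) => //; first exact: laurentB.
  move=> b ba; rewrite -[LHS]/(neumann v b - (\sum_(k < mdeg a) iter k K v) b).
  by rewrite (neumann_trunc lv ba) subrr.
rewrite (neumann_trunc lv (ltnSn _)) big_ord_recl -[RHS]/(v a + K (neumann v) a) KG.
rewrite -[LHS]/(v a + (\sum_(k < mdeg a) iter k.+1 K v) a); congr (_ + _ a).
by rewrite (op_big _ opK) // => k; apply: laurent_iter.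
Qed.

Lemma Kneumann v : laurent v -> neumann (v - K v) = v.
Proof.
move=> lv; have lKv := op_laurent opK lv; apply/funext => a; apply/funext => n.
rewrite (neumann_trunc (laurentB lv lKv) (ltnSn _)).
have -> m : \sum_(k < m) iter k K (v - K v) = v - iter m K v.
  elim: m => [|m IHm]; first by rewrite big_ord0 subrr.
  rewrite big_ord_recr /= IHm (opB (op_iter m)) //.
  by rewrite -iterSr addrA subrK.
by rewrite -[LHS]/(v a n - iter (mdeg a).+1 K v a n) (iter_vanishes_below lv) ?subr0.
Qed.

End Neumann.

(** In a product t^b t^c of degree less than d + 1, either b = 1, where the symbol
    of K vanishes, or c has degree less than d. *)
Lemma raising (S : countType) (R : comPzRingType) (H : lmodType R)
    (K : lser S H -> lser S H) :
    op K -> commutes_tu K -> (forall h, at0 (K (csec h)) = 0) ->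
  forall d v, laurent v -> vanishes_below d v -> vanishes_below d.+1 (K v).
Proof.
move=> oK Ktu K0 d v lv vd a ad; case: (oK) => KB /(_ (fun=> 0))[q qK] _.
have [|sK KE] := @symbol_rep _ _ _ _ q K KB (op_lcontinuous oK) Ktu.
  by move=> h; apply/qK/pole_le_csec.
rewrite KE //; apply/funext => n; rewrite /ext fsbig1 // => -[b c] fe /=.
rewrite fsbig1 // => i _; case: (mon_cases b) => [->|[s [b' bE]]].
  exact: (congr1 (fun w : lser void H => w (mon1 void) (n - i)) (K0 (v c i))).
rewrite vd.
  by rewrite (_ : csec 0 = 0) ?(op0 oK) // -(subrr 0) csecB subrr.
by have := mdeg_factors fe; rewrite /= bE mdeg_mulvar; move: ad; lia.
Qed.

(** * Operators acting on each coefficient *)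

Section Coefficientwise.
Variable S : countType.

Definition slice (M : zmodType) (b : mon S) (w : lser S M) : lser void M := fun _ => w b.

(** The extension of delta that is constant in t. *)
Definition cw (M M' : zmodType) (delta : lser void M -> lser void M') (w : lser S M)
    : lser S M' :=
  fun b n => delta (slice b w) (mon1 void) n.

Lemma op_slice (M : zmodType) b : op (@slice M b).
Proof. by apply: op_coef => a; exists b, 0, (fun=> id); split=> // v n; rewrite addr0. Qed.

Lemma laurent_slice (M : zmodType) b (w : lser S M) : laurent w -> laurent (slice b w).
Proof. exact/op_laurent/op_slice. Qed.

Lemma slice_cw (M M' : zmodType) (delta : lser void M -> lser void M') b w :
  slice b (cw delta w) = delta (slice b w).
Proof. by apply/funext => a; rewrite (mon_void a). Qed.

Lemma op_cw (M M' : zmodType) (delta : lser void M -> lser void M') :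
  op delta -> op (cw delta).
Proof.
move=> od; apply: op_local => a; exists void, (fun w => delta (slice a w)), (mon1 void).
by split=> //; apply: op_comp od (op_slice _ _).
Qed.

Lemma pole_le_cw (M M' : zmodType) (delta : lser void M -> lser void M') c p w :
    (forall m w, pole_le (fun=> m) w -> pole_le (fun=> m + c) (delta w)) ->
  pole_le p w -> pole_le (fun a => p a + c) (cw delta w).
Proof.
by move=> pd pw a n an; apply: (pd (p a)) an => b k; apply: pw.
Qed.

Lemma cw_tm (M M' : zmodType) (delta : lser void M -> lser void M') s w :
  op delta -> cw delta (tm s w) = tm s (cw delta w).
Proof.
move=> od; apply/funext => a; apply/funext => n; rewrite /tm /cw.
have -> : slice a (tm s w) = if a s == 0%N then 0 else slice (unvar s a) w.
  by apply/funext => b; apply/funext => k; rewrite /slice /tm; case: (a s == 0%N).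
by case: (a s == 0%N); rewrite ?(op0 od).
Qed.

Lemma at0_cw (M M' : zmodType) (delta : lser void M -> lser void M') w :
  at0 (cw delta w) = delta (at0 w).
Proof. by apply/funext => a; rewrite (mon_void a). Qed.

End Coefficientwise.

(** * The Taylor isomorphism of a flat t-connection *)

(** The variables of b with multiplicity, in an arbitrary order; it does not
    matter because the N_s commute. *)
Definition mseq (S : countType) (b : mon S) : seq S :=
  flatten [seq nseq (b s) s | s <- finsupp b].

Definition mfact (S : countType) (b : mon S) : nat :=
  (\prod_(s <- finsupp b) (b s)`!)%N.

Section MonomialSequences.
Variable S : countType.
Implicit Types (b : mon S) (s : S).

Lemma count_mseq b s : count_mem s (mseq b) = b s.
Proof.
rewrite /mseq count_flatten -map_comp sumnE big_map.
transitivity (\sum_(r <- finsupp b) if r == s then b s else 0)%N.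
  apply: eq_bigr => r _; rewrite /= count_nseq /=.
  by case: (r =P s) => [->|]; rewrite ?mul1n.
have [sb|sb] := boolP (s \in finsupp b); last first.
  rewrite big_seq big1 ?fsfun_dflt // => r rb.
  by case: eqP => // rs; move: sb; rewrite -rs rb.
rewrite (big_fsetD1 s) //= eqxx big_seq big1 ?addn0 // => r.
by rewrite in_fsetD1 => /andP[/negPf ->].
Qed.

Lemma mseq1 : mseq (mon1 S) = [::].
Proof. by rewrite /mseq finsupp0. Qed.

Lemma mseq_mulvar s b : perm_eq (mseq (mulvar s b)) (s :: mseq b).
Proof.
apply/allP => r _; rewrite /= count_mseq count_mseq mulvarE [s == r]eq_sym.
by rewrite addnC.
Qed.

Lemma mfactE (A : {fset S}) b : (finsupp b `<=` A)%fset ->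
  mfact b = (\prod_(s <- A) (b s)`!)%N.
Proof.
move=> bA; rewrite /mfact (big_fset_incl _ bA) // => s _.
by rewrite memNfinsupp => /eqP ->.
Qed.

Lemma mfact1 : mfact (mon1 S) = 1%N.
Proof. by rewrite /mfact finsupp0 big_seq_fset0. Qed.

Lemma mfact_mulvar s b : mfact (mulvar s b) = ((b s).+1 * mfact b)%N.
Proof.
have bA : (finsupp b `<=` s |` finsupp b)%fset by apply: fsubsetU1.
have sbA : (finsupp (mulvar s b) `<=` s |` finsupp b)%fset.
  by rewrite /mulvar finsupp_with.
rewrite (mfactE bA) (mfactE sbA).
rewrite (big_fsetD1 s) ?fset1U1 //= [in RHS](big_fsetD1 s) ?fset1U1 //=.
rewrite mulvarE eqxx addn1 factS -mulnA; congr (_ * (_ * _))%N.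
rewrite big_seq [RHS]big_seq; apply: eq_bigr => r.
by rewrite in_fsetD1 mulvarE => /andP[/negPf -> _]; rewrite addn0.
Qed.

Lemma mfact_gt0 b : (0 < mfact b)%N.
Proof. by rewrite /mfact prodn_gt0 // => s; apply: fact_gt0. Qed.

End MonomialSequences.

Section Taylor.
Variables (S : countType) (R : comPzRingType) (H : lmodType R) (inv : nat -> R).
Hypothesis invP : forall n, (0 < n)%N -> n%:R * inv n = 1.
Variable N : S -> lser S H -> lser S H.
Hypothesis dN : forall s, is_dt_conn s (N s).
Hypothesis NZ : forall s, scalable_on (N s).
Hypothesis NC : forall s s', commutes (N s) (N s').

Lemma torsion_free n (x : H) : x *+ n.+1 = 0 -> x = 0.
Proof.
move=> xn; rewrite -[x]scale1r -(@invP n.+1) // mulrC -scalerA scaler_nat xn.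
exact: scaler0.
Qed.

Let opN s : op (N s) := op_dt_conn (dN s).

Definition Nseq (l : seq S) (v : lser S H) : lser S H := foldr N v l.

Let op_Nseq l : op (Nseq l).
Proof. by elim: l => [|s l IHl]; [exact: op_id|exact: op_comp (opN s) IHl]. Qed.

Lemma Nseq_commute l s v : laurent v -> Nseq l (N s v) = N s (Nseq l v).
Proof.
move=> lv; elim: l => //= r l ->; apply: NC.
exact: op_laurent (op_Nseq l) lv.
Qed.

Lemma Nseq_perm l l' v : laurent v -> perm_eq l l' -> Nseq l v = Nseq l' v.
Proof.
move=> lv ll'; have comm a b w : laurent w -> Nseq a (Nseq b w) = Nseq b (Nseq a w).
  move=> lw; elim: b => //= s b IHb; rewrite Nseq_commute ?IHb //.
  exact: op_laurent lw.
have NE a b w : Nseq (a ++ b) w = Nseq a (Nseq b w) by rewrite /Nseq foldr_cat.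
pose P a := Nseq a v = Nseq l v.
have PC a b c : P (a ++ b ++ c) -> P (b ++ a ++ c).
  by rewrite /P !NE => <-; rewrite comm //; apply: op_laurent lv.
by symmetry; apply: (catCA_perm_ind PC ll').
Qed.

Definition Nmon (b : mon S) (v : lser S H) : lser S H := Nseq (mseq b) v.

Lemma op_Nmon b : op (Nmon b).
Proof. exact: op_Nseq. Qed.

Lemma Nmon_mulvar s b v : laurent v -> Nmon (mulvar s b) v = Nmon b (N s v).
Proof.
by move=> lv; rewrite /Nmon (Nseq_perm lv (mseq_mulvar s b)) /= Nseq_commute.
Qed.

Lemma Nmon1 v : Nmon (mon1 S) v = v.
Proof. by rewrite /Nmon mseq1. Qed.

(** The coefficients of v in the frame of horizontal sections. *)
Definition taylor (v : lser S H) : lser S H :=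
  fun b n => inv (mfact b) *: Nmon b v (mon1 S) n.

Lemma op_taylor : op taylor.
Proof.
apply: op_local => b.
exists S, (fun v => inv (mfact b) *: Nmon b v), (mon1 S); split=> //.
exact: (op_comp (F := fun v : lser S H => inv (mfact b) *: v)
                (op_scale _ _ _) (op_Nmon b)).
Qed.

Let laurent_taylor v : laurent v -> laurent (taylor v).
Proof. exact/op_laurent/op_taylor. Qed.

(** N^(b t_s) = N^b N_s, and (b t_s)! = (b_s + 1) b!. *)
Lemma dt_taylor s v : laurent v -> dt s (taylor v) = taylor (N s v).
Proof.
move=> lv; apply/funext => b; apply/funext => n.
rewrite /dt /taylor Nmon_mulvar // mfact_mulvar -scaler_nat scalerA; congr (_ *: _).
set m := mfact b; set k := (b s).+1.
have m0 : (0 < m)%N by apply: mfact_gt0.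
have km0 : (0 < k * m)%N by rewrite muln_gt0.
rewrite -[LHS]mul1r -[X in X * _](invP m0) mulrACA -natrM [(m * k)%N]mulnC.
by rewrite [inv m * _]mulrC mulrA (invP km0) mul1r.
Qed.

Lemma at0_taylor v : at0 (taylor v) = at0 v.
Proof.
apply/funext => a; apply/funext => n; rewrite /at0 /taylor mfact1 Nmon1.
by rewrite -[RHS]scale1r -(@invP 1) // mul1r.
Qed.

Lemma taylorZ : scalable_on taylor.
Proof.
move=> r v lv; apply/funext => b; apply/funext => n.
rewrite -[RHS]/(r *: (inv (mfact b) *: Nmon b v (mon1 S) n)) /taylor.
rewrite scalerA mulrC -scalerA; congr (_ *: _).
suff -> : Nmon b (r *: v) = r *: Nmon b v by [].
elim/mon_ind: b v lv => [|s b IHb] v lv; first by rewrite !Nmon1.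
rewrite !Nmon_mulvar //; last exact: laurentZ.
by rewrite NZ // IHb //; apply: op_laurent (opN s) lv.
Qed.

Lemma taylor_um i v : laurent v -> taylor (um i v) = um i (taylor v).
Proof.
move=> lv; apply/funext => b; apply/funext => n; rewrite {2}/um /taylor.
suff -> : Nmon b (um i v) = um i (Nmon b v) by [].
elim/mon_ind: b v lv => [|s b IHb] v lv; first by rewrite !Nmon1.
rewrite !Nmon_mulvar //; last exact: laurent_um.
by rewrite (dt_conn_um _ (dN s)) // IHb //; apply: op_laurent (opN s) lv.
Qed.

(** The defect of linearity is a horizontal map from N to dt which vanishes
    at t = 0. *)
Lemma taylor_tm s v : laurent v -> taylor (tm s v) = tm s (taylor v).
Proof.
move=> lv; apply/eqP; rewrite -subr_eq0; apply/eqP.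
apply: (@intertwiner_eq0 S H H torsion_free N (@dt S H)
  (fun v => taylor (tm s v) - tm s (taylor v))) lv => {v}.
- by move=> r v; apply: op_laurent.
- by move=> r; apply: dt_is_dt_conn.
- by move=> v lv; apply: laurentB; [apply/laurent_taylor|]; apply: laurent_tm => //;
    apply: laurent_taylor.
- move=> r v lv; have lNv := op_laurent (opN r) lv.
  rewrite (opB (op_dt _ r)) ?dt_taylor; [|by [apply/laurent_tm|apply/laurent_taylor/laurent_tm
    |apply/laurent_tm/laurent_taylor]..].
  rewrite (dt_conn_tm _ (dN r)) // dt_tm (opD op_taylor) ?dt_taylor //.
  + case: (r == s); first by rewrite opprD addrACA subrr add0r.
    by rewrite (op0 op_taylor) !add0r.
  + by case: (r == s).
  + exact: laurent_tm.
- move=> v lv; rewrite (opB (op_at0 _ _)); last 2 first.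
  + exact/laurent_taylor/laurent_tm.
  + exact/laurent_tm/laurent_taylor.
  rewrite at0_taylor; apply/funext => a; apply/funext => n.
  by rewrite -[LHS]/(tm s v (mon1 S) n - tm s (taylor v) (mon1 S) n) /tm mon1E eqxx subrr.
Qed.

Lemma taylor_tu : commutes_tu taylor.
Proof. by split=> *; [apply: taylor_tm|apply: taylor_um]. Qed.

(** T is the identity at t = 0, so 1 - T raises the degree in t. *)
Definition untaylor : lser S H -> lser S H := neumann (fun v => v - taylor v).

Let opK : op (fun v => v - taylor v) := op_sub (op_id _ _) op_taylor.

Let Kraise d v : laurent v -> vanishes_below d v -> vanishes_below d.+1 (v - taylor v).
Proof.
move=> lv vd; apply: (@raising S R H (fun v => v - taylor v)) => // [|h].
  split=> [s|i] w lw; rewrite ?taylor_tm ?taylor_um //.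
  by rewrite (opB (op_tm _ s)) //; apply: laurent_taylor.
rewrite (opB (op_at0 _ _)) ?at0_taylor ?subrr //; exact: laurent_taylor.
Qed.

Lemma op_untaylor : op untaylor.
Proof. exact: op_neumann. Qed.

Let laurent_untaylor v : laurent v -> laurent (untaylor v).
Proof. exact/op_laurent/op_untaylor. Qed.

Lemma taylorK v : laurent v -> untaylor (taylor v) = v.
Proof.
by move=> lv; have := Kneumann opK Kraise lv; rewrite opprB addrC subrK.
Qed.

Lemma untaylorK v : laurent v -> taylor (untaylor v) = v.
Proof.
by move=> lv; have := neumannK opK Kraise lv; rewrite opprB addrC subrK.
Qed.

Lemma untaylor_tu : commutes_tu untaylor.
Proof.
split=> [s|i] v lv; have lUv := laurent_untaylor lv.
  by rewrite -{1}(untaylorK lv) -taylor_tm // taylorK //; apply: laurent_tm.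
by rewrite -{1}(untaylorK lv) -taylor_um // taylorK //; apply: laurent_um.
Qed.

Lemma untaylorZ : scalable_on untaylor.
Proof.
move=> r v lv; have lUv := laurent_untaylor lv.
by rewrite -{1}(untaylorK lv) -taylorZ // taylorK //; apply: laurentZ.
Qed.

Lemma at0_untaylor v : laurent v -> at0 (untaylor v) = at0 v.
Proof. by move=> lv; rewrite -[LHS]at0_taylor untaylorK. Qed.

Lemma N_untaylor s v : laurent v -> N s (untaylor v) = untaylor (dt s v).
Proof.
move=> lv; have lUv := laurent_untaylor lv.
rewrite -{2}(untaylorK lv) dt_taylor // taylorK //.
exact: op_laurent (opN s) lUv.
Qed.

(** ** Poles *)

Hypothesis pN : forall m s v, pole_le (fun a => m + (mdeg a)%:Z) v ->
  pole_le (fun a => m + 1 + (mdeg a)%:Z) (N s v).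

Lemma pole_le_taylor m v : pole_le (fun a => m + (mdeg a)%:Z) v ->
  pole_le (fun a => m + (mdeg a)%:Z) (taylor v).
Proof.
move=> pv b n nb; rewrite /taylor.
suff -> : Nmon b v (mon1 S) n = 0 by rewrite scaler0.
elim/mon_ind: b m v pv nb => [|s b IHb] m v pv; first by rewrite Nmon1; apply: pv.
rewrite mdeg_mulvar => nb; rewrite Nmon_mulvar; last by exists (fun a => m + (mdeg a)%:Z).
by apply: (IHb (m + 1)); [exact: pN|lia].
Qed.

Lemma pole_le_untaylor m v : pole_le (fun a => m + (mdeg a)%:Z) v ->
  pole_le (fun a => m + (mdeg a)%:Z) (untaylor v).
Proof.
apply: pole_le_neumann => w pw; apply: pole_leB => //; exact: pole_le_taylor.
Qed.

End Taylor.

(** * Flat extensions of a u-connection *)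

Section PolesOfConnections.
Variables (S : countType) (R : comPzRingType) (H : lmodType R).

Lemma pole_le_du p (v : lser S H) : pole_le p v -> pole_le (fun a => p a + 1) (du v).
Proof. by move=> pv a n an; rewrite /du pv ?mul0rz //; move: an; lia. Qed.

Lemma pole_le_dt p r s (v : lser S H) : (forall a, p (mulvar s a) <= r a) ->
  pole_le p v -> pole_le r (dt s v).
Proof.
by move=> pr pv a n an; rewrite /dt pv ?mul0rn //; have := pr a; move: an; lia.
Qed.

(** d/dt_s moves a coefficient from degree |a| + 1 to |a|, and the pole of the
    symbol has order 1: either way the bound grows by one. *)
Lemma pole_le_conn_dt s (N : lser S H -> lser S H) m v :
  is_conn (@dt S R s) (fun=> 1) N -> pole_le (fun a => m + (mdeg a)%:Z) v ->
  pole_le (fun a => m + 1 + (mdeg a)%:Z) (N v).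
Proof.
move=> /(conn_rep (derivation_dt H s)) [sphi NE] pv.
rewrite NE; last by exists (fun a => m + (mdeg a)%:Z).
apply: pole_leD.
  by apply: (pole_le_dt _ pv) => a; rewrite mdeg_mulvar; lia.
by apply: (pole_le_ext sphi _ pv) => a e /mdeg_factors ->; lia.
Qed.

Lemma pole_le_conn_du (N : lser S H -> lser S H) c m v : 1 <= c ->
  is_conn (@du S R) (fun=> c) N -> pole_le (fun=> m) v -> pole_le (fun=> m + c) (N v).
Proof.
move=> c1 /(conn_rep (derivation_du S H)) [sphi NE] pv; rewrite NE; last by exists (fun=> m).
apply: pole_leD.
  by apply: pole_le_weak (pole_le_du pv) => a; lia.
exact: (pole_le_ext sphi _ pv).
Qed.

Lemma conn_du_um p (N : lser S H -> lser S H) i v : is_conn (@du S R) p N ->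
  laurent v -> N (um i v) = mulz i (um (i - 1) v) + um i (N v).
Proof.
move=> /(conn_rep (derivation_du S H)) [sphi NE] lv; rewrite !NE //; last exact: laurent_um.
rewrite du_um ext_um (opD (op_um _ _ i)) ?addrA //.
  exact: op_laurent lv.
exact: op_laurent (op_of_symbol sphi) lv.
Qed.

Lemma conn_du_tm p (N : lser S H -> lser S H) s v : is_conn (@du S R) p N ->
  laurent v -> N (tm s v) = tm s (N v).
Proof.
move=> /(conn_rep (derivation_du S H)) [sphi NE] lv; rewrite !NE //; last exact: laurent_tm.
rewrite du_tm (ext_tm sphi) (opD (op_tm _ s)) //.
  exact: op_laurent lv.
exact: op_laurent (op_of_symbol sphi) lv.
Qed.

End PolesOfConnections.

Lemma flat_extension_unique (S : countType) (R : comPzRingType) (H : lmodType R)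
    (tf : forall n (x : H), x *+ n.+1 = 0 -> x = 0)
    (N : S -> lser S H -> lser S H) p p' (D D' : lser S H -> lser S H) :
    (forall s, is_dt_conn s (N s)) ->
    is_conn (@du S R) p D -> (forall s, commutes (N s) D) ->
    is_conn (@du S R) p' D' -> (forall s, commutes (N s) D') ->
    agree (restr D') (restr D) ->
  agree D' D.
Proof.
move=> dN cD ND cD' ND' DD'.
have oD := op_conn (derivation_du S H) cD; have oD' := op_conn (derivation_du S H) cD'.
have oN s := op_dt_conn (dN s).
suff D0 v : laurent v -> D' v - D v = 0 by move=> v /D0 /subr0_eq.
apply: (@intertwiner_eq0 S H H tf N N (fun v => D' v - D v)) => // {v}.
- by move=> s v; apply: op_laurent.
- by move=> v lv; apply: laurentB; apply: op_laurent lv.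
- move=> s v lv; rewrite (opB (oN s)); [|exact: op_laurent lv..].
  by congr (_ - _); [apply: ND'|apply: ND].
- move=> v lv; have lv0 := op_laurent (op_at0 _ _) lv.
  rewrite (opB (op_at0 _ _)); [|exact: op_laurent lv..].
  rewrite (at0_tlocal (tlocal_conn_du cD')) // (at0_tlocal (tlocal_conn_du cD)) //.
  by rewrite DD' // subrr.
Qed.

Section Existence.
Variables (S : countType) (R : comPzRingType) (H : lmodType R) (inv : nat -> R).
Hypothesis invP : forall n, (0 < n)%N -> n%:R * inv n = 1.
Variable N : S -> lser S H -> lser S H.
Hypothesis cN : forall s, is_conn (@dt S R s) (fun=> 1) (N s).
Hypothesis NC : forall s s', commutes (N s) (N s').
Variable delta : lser void H -> lser void H.
Hypothesis cdelta : is_conn (@du void R) (fun=> 2) delta.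

Let dN s : is_dt_conn s (N s) := conn_is_dt (cN s).
Let NZ s : scalable_on (N s).
Proof. by case: (cN s) => _ rN _ _ _; apply: rlinearZ. Qed.
Let odelta : op delta := op_conn (derivation_du void H) cdelta.
Let deltaZ : scalable_on delta.
Proof. by case: cdelta => _ rN _ _ _; apply: rlinearZ. Qed.

Local Notation T := (taylor inv N).
Local Notation U := (untaylor inv N).

Let oT : op T := op_taylor inv dN.
Let oU : op U := op_untaylor invP dN NC.
Let ocw : op (@cw S _ _ delta) := op_cw S odelta.

(** In the Taylor trivialization the t-connection is d/dt, which commutes with
    the constant extension of delta. *)
Definition flat_ext (v : lser S H) : lser S H := U (cw delta (T v)).

Lemma op_flat_ext : op flat_ext.
Proof. exact: op_comp oU (op_comp ocw oT). Qed.

Lemma cw_um i (w : lser S H) : laurent w ->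
  cw delta (um i w) = mulz i (um (i - 1) w) + um i (cw delta w).
Proof.
move=> lw; apply/funext => b; apply/funext => n; rewrite /cw.
rewrite -[slice b _]/(um i (slice b w)) (conn_du_um _ cdelta) //.
exact: laurent_slice.
Qed.

Lemma cwZ : scalable_on (@cw S _ _ delta).
Proof.
move=> r w lw; apply/funext => b; apply/funext => n; rewrite /cw.
rewrite -[slice b _]/(r *: slice b w) deltaZ //; exact: laurent_slice.
Qed.

Lemma cw_dt s (w : lser S H) : laurent w -> cw delta (dt s w) = dt s (cw delta w).
Proof.
move=> lw; apply/funext => b; apply/funext => n; rewrite /cw /dt.
rewrite (_ : slice b _ = (b s).+1%:R *: slice (mulvar s b) w).
  rewrite deltaZ; last exact: laurent_slice.
  by rewrite -scaler_nat.
by apply/funext => a; apply/funext => k; rewrite -[RHS]/(_ *: w _ _) scaler_nat.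
Qed.

Lemma flat_ext_commutes s : commutes (N s) flat_ext.
Proof.
move=> v lv; rewrite /= /flat_ext.
have lTv := op_laurent oT lv; have lc := op_laurent ocw lTv.
by rewrite (N_untaylor invP dN NC) // -cw_dt // (dt_taylor invP dN NC).
Qed.

Lemma flat_ext_conn : is_conn (@du S R) (fun a => 2 + (mdeg a)%:Z) flat_ext.
Proof.
have [Tt Tu] := taylor_tu invP dN NC; have [Ut Uu] := untaylor_tu invP dN NC.
apply: (conn_of_tu (derivation_du S H)).
- exact: op_flat_ext.
- move=> r v lv; have lTv := op_laurent oT lv; have lc := op_laurent ocw lTv.
  by rewrite /flat_ext (taylorZ inv dN NZ NC) // cwZ // (untaylorZ invP dN NZ NC).
- split=> [s|i] v lv; have lTv := op_laurent oT lv; have lc := op_laurent ocw lTv.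
    rewrite /flat_ext Tt // cw_tm // Ut // du_tm (opB (op_tm _ s)) //.
      exact: op_laurent lc.
    exact: op_laurent lv.
  have lDv := op_laurent op_flat_ext lv.
  have lm (w : lser S H) : laurent w -> laurent (mulz i w).
    by move=> lw; rewrite mulzE; apply: laurentZ.
  rewrite /flat_ext Tu // cw_um // (opD oU); last 2 first.
  + exact/lm/laurent_um.
  + exact: laurent_um.
  rewrite Uu // mulzE (untaylorZ invP dN NZ NC) ?Uu ?(taylorK invP dN NC) //; last first.
    exact: laurent_um.
  rewrite -mulzE du_um opprD addrACA subrr add0r (opB (op_um _ _ i)) //.
  exact: op_laurent lv.
- move=> v pv; have pN m s w := @pole_le_conn_dt S R H s (N s) m w (cN s).
  have pTv : pole_le (fun a => 0 + (mdeg a)%:Z) (T v).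
    by apply: (pole_le_taylor inv dN NC pN); apply: pole_le_weak pv => a; lia.
  apply: (pole_le_untaylor inv dN NC pN).
  apply: pole_le_weak (pole_le_cw (c := 2) _ pTv); first by move=> a; lia.
  by move=> m w; apply: pole_le_conn_du.
Qed.

Lemma restr_flat_ext : agree (restr flat_ext) delta.
Proof.
move=> w lw; have ll := op_laurent (op_lift0 S _) lw.
have lTv := op_laurent oT ll; have lc := op_laurent ocw lTv.
by rewrite /restr /flat_ext (at0_untaylor invP dN NC) // at0_cw
  (at0_taylor invP) at0_lift0.
Qed.

End Existence.

(** * Pullback of connections *)

Section ScalableSymbols.
Variables (S : countType) (R : comPzRingType).

Lemma csecZ (H : lmodType R) (r : R) (h : H) : csec (r *: h) = r *: csec h :> lser S H.
Proof.
apply/funext => a; apply/funext => n; rewrite -[RHS]/(r *: csec h a n) /csec /emb.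
by do 2?case: eqP => _; rewrite ?scaler0.
Qed.

Lemma ext_scalable (H H' : lmodType R) q (phi : H -> lser S H') : symbol q phi ->
  (forall r h, phi (r *: h) = r *: phi h) -> scalable_on (ext phi).
Proof.
move=> sphi phiZ r v lv; have oE := op_of_symbol sphi.
apply: (op_eq_gens (F := fun v => ext phi (r *: v)) (G := fun v => r *: ext phi v)) lv.
- exact: (op_comp oE (op_scale _ _ r)).
- exact: (op_comp (op_scale _ _ r) oE).
- move=> i h; rewrite scale_um -csecZ !ext_um !(ext_csec sphi) phiZ.
  by rewrite -scale_um.
- by move=> s {}v lv IH; rewrite scale_tm !(ext_tm sphi) IH scale_tm.
Qed.

Lemma conn_of_symbol (H : lmodType R) d dH c (phi : H -> lser S H) :
    derivation d dH -> symbol (fun=> c) phi -> (forall r h, phi (r *: h) = r *: phi h) ->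
    (forall v, pole_le (fun=> 0) v -> pole_le (fun=> c) (dH v)) ->
  is_conn d (fun=> c) (fun v => dH v + ext phi v).
Proof.
move=> der sphi phiZ pd; have [od odH dHZ dH0 dHl] := der.
have oE := op_of_symbol sphi; have oN := op_add odH oE.
apply: (conn_of_tu der oN).
- by move=> r v lv; rewrite dHZ // (ext_scalable sphi phiZ) // scalerDr.
- have NE v : dH v + ext phi v - dH v = ext phi v by rewrite addrC addKr.
  have [Et Eu] := commutes_tu_ext sphi.
  by split=> [s|i] v lv; rewrite !NE ?Et ?Eu.
- move=> v pv; apply: pole_leD; first exact: pd.
  by apply: (pole_le_ext sphi _ pv) => a e _; rewrite add0r.
Qed.

End ScalableSymbols.

Section EmbeddedSeries.
Variables (S : countType) (R : comPzRingType) (H : lmodType R).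

Lemma pole_le_emb (M : zmodType) p (g : ser S M) : (forall a, 0 <= p a) -> pole_le p (emb g).
Proof.
by move=> p0 a n an; rewrite /emb; case: eqP => // n0; exfalso; have := p0 a; move: an; lia.
Qed.

Lemma lmul_emb (g : ser S R) (v : lser S H) a n :
  lmul (emb g) v a n = \sum_(e <- fset_set (factors a)) g e.1 *: v e.2 n.
Proof.
rewrite -(fsbig_finite _ _ (finite_factors a)).
rewrite /lmul /ext; apply: eq_fsbigr => e _; rewrite -(fsbig_widen [set n]) //.
  by rewrite fsbig_set1 /emb subrr eqxx.
by move=> i [_ ni]; rewrite /= /emb subr_eq0; case: eqP => [nE|_]; [case: ni|rewrite scale0r].
Qed.

Lemma pole_le_lmul m (g : lser S R) (v : lser S H) : pole_le (fun=> 0) g ->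
  pole_le (fun=> m) v -> pole_le (fun=> m) (lmul g v).
Proof. by move=> pg; apply: (pole_le_ext (symbol_lmul H pg)) => a e _; lia. Qed.

Lemma lmulZ (g : lser S R) : laurent g -> scalable_on (fun v : lser S H => lmul g v).
Proof.
move=> [q pg]; apply: (ext_scalable (symbol_lmul H pg)) => r h.
apply/funext => a; apply/funext => n.
by rewrite -[RHS]/(r *: (g a n *: h)) !scalerA mulrC.
Qed.

Lemma lmulC (g g' : lser S R) (v : lser S H) : laurent g -> laurent g' -> laurent v ->
  lmul g (lmul g' v) = lmul g' (lmul g v).
Proof.
move=> lg lg' lv; apply: (commutes_tu_linear (op_lmul H lg) (lmulZ lg)) => //.
by split=> *; rewrite ?lmul_tm ?lmul_um.
Qed.

Lemma lmul_local (g : lser S R) (v w : lser S H) a :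
  (forall e, factors a e -> v e.2 = w e.2) -> lmul g v a = lmul g w a.
Proof. exact: ext_local. Qed.

Lemma lmul_eq0 (g : lser S R) (v : lser S H) a :
  (forall e, factors a e -> g e.1 = 0) -> lmul g v a = 0.
Proof.
move=> g0; apply/funext => n; rewrite /lmul /ext fsbig1 // => e fe.
by rewrite fsbig1 // => i _; rewrite g0 // scale0r.
Qed.

End EmbeddedSeries.

Section Pullback.
Variables (S' S : countType) (R : comPzRingType) (f : ser S' R -> ser S R).
Hypothesis falg : is_alg_map f.

Let f0 : f (fun=> 0) = (fun=> 0).
Proof.
case: falg => fD _ _ _; have := fD (-1) (fun=> 0) (fun=> 0).
have -> : (fun a : mon S' => -1 * 0 + 0) = (fun=> 0 : R).
  by apply/funext => a; rewrite mulr0 addr0.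
by move=> ->; apply/funext => a; rewrite mulN1r addNr.
Qed.

(** f (t^b) tends to 0 by continuity. *)
Lemma alg_map_finite a : exists E : {fset mon S'},
  forall b, b \notin E -> f (tmon R b) a = 0.
Proof.
case: falg => _ _ _ /(_ (fun=> 0) a)[E EP]; exists E => b bE.
rewrite EP ?f0 // => c cE; rewrite /tmon; case: eqP => // cb.
by move: bE; rewrite -cb cE.
Qed.

Lemma alg_map_tmonM r b a : f (tmon R (mulvar r b)) a =
  \sum_(e <- fset_set (factors a)) f (tvar R r) e.1 * f (tmon R b) e.2.
Proof.
rewrite -(fsbig_finite _ _ (finite_factors a)).
case: falg => _ _ fM _; have := fM (tvar R r) (tmon R b).
move=> /(congr1 (fun g : ser S R => g a)) /= <-; congr (f _ a).
apply/funext => c; rewrite /tvar /tmon; case: eqP => [->|cb].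
  rewrite -(fsbig_widen [set (mulvar r (mon1 S'), b)]).
  - by rewrite fsbig_set1 !eqxx mulr1.
  - by move=> _ -> s /=; rewrite !mulvarE mon1E add0n addnC.
  - move=> [c1 c2] [fc ne] /=; case: eqP => [c1E|]; last by rewrite mul0r.
    case: eqP => [c2E|]; last by rewrite mulr0.
    by case: ne; rewrite /= c1E c2E.
rewrite fsbig1 // => -[c1 c2] fc /=; case: eqP => [c1E|]; last by rewrite mul0r.
case: eqP => [c2E|]; last by rewrite mulr0.
case: cb; apply/fsfunP => s; rewrite -(fc s) /= c1E c2E !mulvarE mon1E.
by rewrite add0n addnC.
Qed.

Section Module.
Variable H : lmodType R.
Local Notation pull := (@pullv S' S R H f).

Lemma pullv_fin a : exists E : {fset mon S'}, forall v n,
  pull v a n = \sum_(b <- E) f (tmon R b) a *: v b n.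
Proof.
have [E EP] := alg_map_finite a; exists E => v n.
by rewrite /pullv (fsbigTE E) // => b /EP ->; rewrite scale0r.
Qed.

Lemma op_pullv : op pull.
Proof.
apply: op_local => a; have [E EP] := pullv_fin a.
exists S, (fun v => \sum_(b <- E) (fun a n => f (tmon R b) a *: v b n : H)), a.
split=> [|v n lv].
  apply: op_sum => b; apply: op_coef => c.
  exists b, 0, (fun _ x => f (tmon R b) c *: x).
  by split=> [n x y|v n]; rewrite ?scalerBr // addr0.
by rewrite EP !fct_sumE.
Qed.

Lemma pullvZ : scalable_on pull.
Proof.
move=> r v lv; apply/funext => a; apply/funext => n; have [E EP] := pullv_fin a.
rewrite -[RHS]/(r *: pull v a n) !EP scaler_sumr; apply: eq_bigr => b _.
by rewrite -[(r *: v) b n]/(r *: v b n) !scalerA mulrC.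
Qed.

Lemma pullv_um i v : pull (um i v) = um i (pull v).
Proof. by []. Qed.

Lemma pole_le_pullv m v : pole_le (fun=> m) v -> pole_le (fun=> m) (pull v).
Proof.
by move=> pv a n an; rewrite /pullv fsbig1 // => b _; rewrite pv // scaler0.
Qed.

Lemma pullv_mono b i h :
  pull (mono b i h) = fun a n => if n == i then f (tmon R b) a *: h else 0.
Proof.
apply/funext => a; apply/funext => n; rewrite /pullv -(fsbig_widen [set b]) //.
  by rewrite fsbig_set1 /mono eqxx /=; case: eqP => _; rewrite ?scaler0.
by move=> c [_ /eqP/negPf cb]; rewrite /= /mono cb scaler0.
Qed.

Lemma pullv_csec h : pull (csec h) = csec h.
Proof.
rewrite csec_eq pullv_mono csec_eq; apply/funext => a; apply/funext => n.
case: falg => _ -> _ _; rewrite /tmon /mono andbC; case: eqP => //= _.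
by case: eqP; rewrite ?scale1r ?scale0r.
Qed.

Let lemb (g : ser S R) : laurent (emb g).
Proof. by exists (fun=> 0); apply: pole_le_emb. Qed.

(** On monomials this is the multiplicativity of f. *)
Lemma pullv_tm r v : laurent v -> pull (tm r v) = lmul (emb (f (tvar R r))) (pull v).
Proof.
apply: (op_eq_mono (F := fun v => pull (tm r v))
          (G := fun v => lmul (emb (f (tvar R r))) (pull v))).
- exact: op_comp op_pullv (op_tm _ r).
- exact: op_comp (op_lmul H (lemb _)) op_pullv.
- move=> b i h; rewrite -mono_mulvar !pullv_mono; apply/funext => a; apply/funext => n.
  rewrite [RHS]lmul_emb; case: (n == i); last first.
    by rewrite big1 // => e _; rewrite scaler0.
  have fE := alg_map_tmonM r b a; rewrite [X in X *: h]fE scaler_suml.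
  by apply: eq_bigr => e _; rewrite scalerA.
Qed.

(** ** Pullback of a flat connection *)

Variable N : S' -> lser S' H -> lser S' H.
Variable D : lser S' H -> lser S' H.
Hypothesis cN : forall r, is_conn (@dt S' R r) (fun=> 1) (N r).
Hypothesis cD : is_conn (@du S' R) (fun=> 2) D.
Hypothesis ND : forall r, commutes (N r) D.

Let dN r : is_dt_conn r (N r) := conn_is_dt (cN r).
Let oN r : op (N r) := op_dt_conn (dN r).
Let oD : op D := op_conn (derivation_du S' H) cD.
Let NZ r : scalable_on (N r).
Proof. by case: (cN r) => _ h _ _ _; apply: rlinearZ. Qed.
Let DZ : scalable_on D.
Proof. by case: cD => _ h _ _ _; apply: rlinearZ. Qed.

(** The coefficient d(f t_r)/dt_s of the chain rule. *)
Definition dcoef (s : S) (r : S') : lser S R := dt s (emb (f (tvar R r))).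

Let pc s r : pole_le (fun=> 0) (dcoef s r).
Proof. by apply: (pole_le_dt (H := R^o) (p := fun=> 0)) => //; apply: pole_le_emb. Qed.

Let lc s r : laurent (dcoef s r).
Proof. by exists (fun=> 0). Qed.

Lemma du_dcoef s r : du (dcoef s r) = 0.
Proof.
apply/funext => a; apply/funext => n; rewrite /du /dcoef /dt /emb.
by case: eqP => [->|_]; rewrite ?mulr0z // mul0rn mul0rz.
Qed.

Definition divides (d a : mon S) : Prop := exists x, factors a (x, d).

Lemma divides_refl a : divides a a.
Proof. by exists (mon1 S); apply: factors_1l. Qed.

Lemma divides_fst a e : factors a e -> divides e.1 a.
Proof. by move=> fe; exists e.2; apply: factors_swap. Qed.

Lemma divides_snd a e : factors a e -> divides e.2 a.
Proof. by move=> fe; exists e.1; rewrite -surjective_pairing. Qed.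

Lemma divides_trans a b c : divides a b -> divides b c -> divides a c.
Proof.
move=> [x fx] [y fy]; have [z fz] := factors_trans fy fx; by exists z.
Qed.

(** Up to a given degree, only finitely many of the variables contribute to
    the chain rule. *)
Lemma dcoef_finite s a : exists E : {fset S'},
  forall r, r \notin E -> forall d, divides d a -> dcoef s r d = 0.
Proof.
have /choice[E0 E0P] := alg_map_finite.
exists (\bigcup_(e <- fset_set (factors a))
          \bigcup_(b <- E0 (mulvar s e.2)) finsupp b)%fset => r rE d [x fx].
apply/funext => n; rewrite /dcoef /dt /emb; case: eqP => _; last exact: mul0rn.
rewrite E0P ?mul0rn //; apply/negP => rE0; move/negP: rE; apply.
apply/bigfcupP; exists (x, d).
  by rewrite (in_fset_set (finite_factors a)) (mem_set fx).
apply/bigfcupP; exists (mulvar r (mon1 S')); rewrite ?rE0 //.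
by rewrite mem_finsupp mulvarE eqxx addn1.
Qed.

Definition chain (s : S) (W : S' -> lser S H) : lser S H :=
  fun a n => \sum_(r \in [set: S']) lmul (dcoef s r) (W r) a n.

Lemma chain_fin s a : exists E0 : {fset S'}, forall (E : {fset S'}) d W,
    (E0 `<=` E)%fset -> divides d a ->
  chain s W d = (\sum_(r <- E) lmul (dcoef s r) (W r)) d.
Proof.
have [E0 E0P] := dcoef_finite s a; exists E0 => E d W EE da; apply/funext => n.
rewrite /chain (fsbigTE E) ?fct_sumE // => r rE.
rewrite lmul_eq0 // => e fe; apply: (E0P r).
  by apply/negP => /(fsubsetP EE); apply/negP.
exact: divides_trans (divides_fst fe) da.
Qed.

(** nabla_(d/dt_s) on v (x) 1, computed by the chain rule. *)
Definition chainN (s : S) (v : lser S' H) : lser S H := chain s (fun r => pull (N r v)).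

Let oX s r : op (fun v => lmul (dcoef s r) (pull (N r v))) :=
  op_comp (op_lmul H (lc s r)) (op_comp op_pullv (oN r)).

Lemma op_chainN s : op (chainN s).
Proof.
apply: op_local => a; have [E EP] := chain_fin s a.
exists S, (fun v => \sum_(r <- E) lmul (dcoef s r) (pull (N r v))), a.
split=> [|v n lv]; first by apply: op_sum => r; apply: oX.
by rewrite /chainN (EP E) //; apply: divides_refl.
Qed.

Let pole_chainN s h : pole_le (fun=> 1) (chainN s (csec h)).
Proof.
move=> a n an; rewrite /chainN /chain fsbig1 // => r _.
apply: (pole_le_lmul (m := 1)) an => //; apply: pole_le_pullv.
by case: (cN r) => _ _ _ pN _; apply/pN/pole_le_csec.
Qed.

Lemma chainN_um s i v : laurent v -> chainN s (um i v) = um i (chainN s v).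
Proof.
move=> lv; apply/funext => a; apply/funext => n.
rewrite {2}/um /chainN /chain; apply: eq_fsbigr => r _.
by rewrite (dt_conn_um i (dN r)) // pullv_um lmul_um.
Qed.

Lemma chainNZ s : scalable_on (chainN s).
Proof.
move=> c v lv; apply/funext => a; have [E EP] := chain_fin s a.
rewrite -[RHS]/(c *: chainN s v a) /chainN !(EP E) //; try exact: divides_refl.
rewrite -[RHS]/((c *: \sum_(r <- E) lmul (dcoef s r) (pull (N r v))) a) scaler_sumr.
congr (_ a); apply: eq_bigr => r _; have lNv := op_laurent (oN r) lv.
have lp := op_laurent op_pullv lNv.
by rewrite NZ // pullvZ // lmulZ.
Qed.

Let symb_nt s : symbol (fun=> 1) (fun h => chainN s (csec h)) :=
  symbol_op (op_chainN s) (pole_chainN s).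

Lemma conn_pull_nt s : is_conn (@dt S R s) (fun=> 1) (pull_nt f N s).
Proof.
apply: (conn_of_symbol (derivation_dt H s) (symb_nt s)) => //.
  by move=> r h; rewrite csecZ chainNZ.
by move=> v; apply: pole_le_dt.
Qed.

Let oD0 : op (fun v => pull (D v)) := op_comp op_pullv oD.

Let symb_nu : symbol (fun=> 2) (fun h => pull (D (csec h))).
Proof.
apply: (symbol_op oD0) => h; apply: pole_le_pullv.
by case: cD => _ _ _ pD _; apply/pD/pole_le_csec.
Qed.

Lemma conn_pull_nu : is_conn (@du S R) (fun=> 2) (pull_nu f D).
Proof.
apply: (conn_of_symbol (derivation_du S H) symb_nu) => //.
  by move=> r h; rewrite csecZ DZ // pullvZ //; apply: op_laurent (laurent_csec _ _).
by move=> v pv; apply: pole_le_weak (pole_le_du pv).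
Qed.

Let oPN s := op_conn (derivation_dt H s) (conn_pull_nt s).
Let oPD := op_conn (derivation_du S H) conn_pull_nu.

Lemma pull_nt_csec s h : pull_nt f N s (csec h) = chainN s (csec h).
Proof.
rewrite -[LHS]/(dt s (csec h) + ext (fun h => chainN s (csec h)) (csec h)).
by rewrite dt_csec add0r (ext_csec (symb_nt s)).
Qed.

Lemma pull_nu_csec h : pull_nu f D (csec h) = pull (D (csec h)).
Proof.
rewrite -[LHS]/(du (csec h) + ext (fun h => pull (D (csec h))) (csec h)).
by rewrite du_csec add0r (ext_csec symb_nu).
Qed.

Lemma chainN_tm s r v : laurent v -> chainN s (tm r v) =
  lmul (dcoef s r) (pull v) + lmul (emb (f (tvar R r))) (chainN s v).
Proof.
move=> lv; set g := emb _; have lg : laurent g by apply: lemb.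
have lp := op_laurent op_pullv lv.
have lX q := op_laurent op_pullv (op_laurent (oN q) lv).
apply/funext => a; have [E0 EP] := chain_fin s a.
pose E := (r |` E0)%fset; have EE : (E0 `<=` E)%fset by apply: fsubsetU1.
have lcX q : laurent (lmul (dcoef s q) (pull (N q v))) by apply: laurent_lmul.
rewrite -[RHS]/(lmul (dcoef s r) (pull v) a + lmul g (chainN s v) a).
rewrite (@lmul_local _ _ _ _ (chainN s v)
  (\sum_(q <- E) lmul (dcoef s q) (pull (N q v)))); last first.
  by move=> e fe; rewrite /chainN (EP E) //; apply: divides_snd.
rewrite /chainN (EP E) //; last exact: divides_refl.
rewrite -[RHS]/((lmul (dcoef s r) (pull v) +
  lmul g (\sum_(q <- E) lmul (dcoef s q) (pull (N q v)))) a); congr (_ a).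
rewrite (op_big _ (op_lmul H lg) lcX).
transitivity (\sum_(q <- E) ((if q == r then lmul (dcoef s q) (pull v) else 0) +
    lmul (dcoef s q) (lmul g (pull (N q v))))).
  apply: eq_bigr => q _; rewrite (dt_conn_tm _ (dN q)) //.
  have lNv := op_laurent (oN q) lv.
  have ltN : laurent (tm r (N q v)) by apply: laurent_tm.
  have lif : laurent (if q == r then v else 0) by case: (q == r).
  rewrite (opD op_pullv) // (opD (op_lmul H (lc s q))); last 2 first.
  - exact: op_laurent op_pullv lif.
  - exact: op_laurent op_pullv ltN.
  rewrite pullv_tm //; congr (_ + _); case: (q == r) => //.
  by rewrite (op0 op_pullv) (op0 (op_lmul H (lc s q))).
rewrite big_split /=; congr (_ + _); last by apply: eq_bigr => q _; rewrite lmulC.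
rewrite (big_fsetD1 r) ?fset1U1 //= eqxx big_seq big1 ?addr0 // => q.
by rewrite in_fsetD1 => /andP[/negPf ->].
Qed.

(** On the sections v (x) 1, the pulled back connection is given by the chain
    rule: both sides satisfy the same Leibniz rule in v. *)
Lemma pull_nt_pullv s v : laurent v -> pull_nt f N s (pull v) = chainN s v.
Proof.
apply: (op_eq_gens (F := fun v => pull_nt f N s (pull v)) (G := chainN s)).
- exact: op_comp (oPN s) op_pullv.
- exact: op_chainN.
- move=> i h; rewrite pullv_um pullv_csec chainN_um // -pull_nt_csec.
  by rewrite (dt_conn_um i (conn_is_dt (conn_pull_nt s))).
- move=> r {}v lv IH; rewrite pullv_tm // chainN_tm // -IH.
  case: (conn_pull_nt s) => _ _ lei _ _; apply: lei => //.
  exact: op_laurent op_pullv lv.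
Qed.

Let du_emb (g : ser S R) : du (emb g) = 0.
Proof.
apply/funext => a; apply/funext => n; rewrite /du /emb.
by case: eqP => [->|_]; rewrite ?mulr0z ?mul0rz.
Qed.

Let pull_nu_lmul (g : lser S R) w : laurent g -> du g = 0 -> laurent w ->
  pull_nu f D (lmul g w) = lmul g (pull_nu f D w).
Proof.
move=> lg dg lw; case: conn_pull_nu => _ _ lei _ _.
rewrite lei // -[LHS]/(lmul (du g) w + lmul g (pull_nu f D w)) dg.
by rewrite (op0 (op_lmul_l lw)) add0r.
Qed.

Lemma pull_nu_pullv v : laurent v -> pull_nu f D (pull v) = pull (D v).
Proof.
apply: (op_eq_gens (F := fun v => pull_nu f D (pull v)) (G := fun v => pull (D v))).
- exact: op_comp oPD op_pullv.
- exact: oD0.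
- move=> i h; rewrite pullv_um pullv_csec (conn_du_um _ conn_pull_nu) //.
  have lDh : laurent (D (csec h)) by apply: op_laurent (laurent_csec _ _).
  rewrite (conn_du_um _ cD) // pull_nu_csec (opD op_pullv); last 2 first.
  + by rewrite mulzE; apply/laurentZ/laurent_um.
  + exact: laurent_um.
  by rewrite !mulzE pullvZ ?pullv_um ?pullv_csec //; apply: laurent_um.
- move=> r {}v lv IH; have lp := op_laurent op_pullv lv.
  rewrite pullv_tm // pull_nu_lmul // IH (conn_du_tm _ cD) // pullv_tm //.
  exact: op_laurent lv.
Qed.

(** The coefficients d(f t_r)/dt_s do not depend on u, so that the flatness of
    N and D can be used term by term. *)
Lemma pull_nu_chainN s v : laurent v -> pull_nu f D (chainN s v) = chainN s (D v).
Proof.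
move=> lv; apply/funext => a; have [E EP] := chain_fin s a.
have lX q : laurent (lmul (dcoef s q) (pull (N q v))) by apply: op_laurent (oX s q) lv.
transitivity (pull_nu f D (\sum_(q <- E) lmul (dcoef s q) (pull (N q v))) a).
  apply: (tlocal_conn_du conn_pull_nu).
  - exact: op_laurent (op_chainN s) lv.
  - exact: laurent_sum.
  - by move=> e fe; rewrite /chainN (EP E) //; apply: divides_snd.
rewrite (op_big _ oPD lX) /chainN (EP E) //; last exact: divides_refl.
congr (_ a); apply: eq_bigr => q _; have lNv := op_laurent (oN q) lv.
rewrite pull_nu_lmul ?du_dcoef ?pull_nu_pullv //; last exact: op_laurent op_pullv lNv.
by congr (lmul _ (pull _)); rewrite -[LHS]/((D \o N q) v) -ND.
Qed.

(** It is enough to compare on constant sections, which are pulled back. *)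
Lemma pull_flat s : commutes (pull_nt f N s) (pull_nu f D).
Proof.
have dPN := conn_is_dt (conn_pull_nt s).
apply: op_eq_gens.
- exact: op_comp (oPN s) oPD.
- exact: op_comp oPD (oPN s).
- move=> i h /=; have -> : um i (csec h) = pull (um i (csec h)).
    by rewrite pullv_um pullv_csec.
  have lh : laurent (um i (csec h) : lser S' H) by apply: laurent_um.
  rewrite pull_nu_pullv // !pull_nt_pullv //; last exact: op_laurent lh.
  by rewrite pull_nu_chainN.
- move=> r v lv /= IH; have lDv := op_laurent oPD lv; have lNv := op_laurent (oPN s) lv.
  have lif : laurent (if s == r then v else 0) by case: (s == r).
  rewrite (conn_du_tm _ conn_pull_nu) // !(dt_conn_tm _ dPN) // IH.
  rewrite (opD oPD) //; last exact: laurent_tm.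
  rewrite (conn_du_tm _ conn_pull_nu) //; congr (_ + _).
  by case: (s == r); rewrite ?(op0 oPD).
Qed.

End Module.
End Pullback.

(** * Isomorphisms and their restriction to t = 0 *)

Lemma pole_le_linear_map (S : countType) (R : comPzRingType) (H H' : lmodType R)
    (F : lser S H -> lser S H') m v :
  is_linear_map F -> pole_le (fun=> m) v -> pole_le (fun=> m) (F v).
Proof.
move=> /linear_map_rep [sF FE] pv; rewrite FE; last by exists (fun=> m).
by apply: (pole_le_ext sF _ pv) => a e _; rewrite addr0.
Qed.

Section Isomorphisms.
Variables (S : countType) (R : comPzRingType).

Lemma at0_csec (M : zmodType) (h : M) : at0 (csec h : lser S M) = csec h.
Proof.
by apply/funext => a; apply/funext => n; rewrite (mon_void a) /at0 /csec /emb !eqxx.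
Qed.

Lemma linear_map_restr (H H' : lmodType R) (F : lser S H -> lser S H') :
  is_linear_map F -> is_linear_map (restr F).
Proof.
move=> lF; have oF := op_linear_map lF; have [Ft Fu] := linear_map_tu lF.
apply: linear_map_of_tu.
- exact: op_restr.
- move=> r w lw; rewrite /restr.
  have -> : Defs.lift0 (r *: w) = r *: Defs.lift0 w :> lser S H.
    apply/funext => a; apply/funext => n; rewrite -[RHS]/(r *: Defs.lift0 w a n) /Defs.lift0.
    by case: eqP => // _; rewrite scaler0.
  case: lF => _ rF _ _ _; rewrite (rlinearZ rF) //; exact: op_laurent (op_lift0 _ _) lw.
- split=> [[]|i w lw]; have ll := op_laurent (op_lift0 S _) lw.
  have liftE : Defs.lift0 (um i w) = um i (Defs.lift0 w) :> lser S H.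
    by apply/funext => a; apply/funext => n; rewrite /um /Defs.lift0; case: eqP.
  by rewrite /restr liftE Fu.
- move=> w pw a n; apply: (pole_le_linear_map (m := 0) lF) => {a n} a n an.
  by rewrite /Defs.lift0; case: eqP => // _; apply: pw.
Qed.

Lemma restrK (H1 H2 : lmodType R) (F : lser S H1 -> lser S H2)
    (G : lser S H2 -> lser S H1) :
  is_linear_map F -> is_linear_map G -> agree (G \o F) id ->
  agree (restr G \o restr F) id.
Proof.
move=> lF lG GF w lw; have ll := op_laurent (op_lift0 S _) lw.
rewrite -[LHS]/(restr G (restr F w)).
rewrite (restr_comp (tlocal_linear_map lG) (op_linear_map lF)) //.
by rewrite -[G _]/((G \o F) (Defs.lift0 w)) GF // at0_lift0.
Qed.

Lemma linear_iso_restr (H H' : lmodType R) (F : lser S H -> lser S H') :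
  is_linear_iso F -> is_linear_iso (restr F).
Proof.
move=> [lF [G [lG GF FG]]]; split; first exact: linear_map_restr.
by exists (restr G); split; [exact: linear_map_restr|exact: restrK|exact: restrK].
Qed.

(** Let Psi0 be the inverse of F at t = 0, extended constantly in t. Then
    K = 1 - Psi0 F vanishes at t = 0, hence raises the degree, and the inverse of
    F is (1 + K + K^2 + ...) Psi0. *)
Lemma linear_iso_of_restr (H H' : lmodType R) (F : lser S H -> lser S H') :
  is_linear_map F -> is_linear_iso (restr F) -> is_linear_iso F.
Proof.
move=> lF [_ [Psi0 [lP PF FP]]]; split=> //.
have oF := op_linear_map lF; have [Ft Fu] := linear_map_tu lF.
have oP := op_linear_map lP; have [_ Pu] := linear_map_tu lP.
pose L := @cw S _ _ Psi0; have oL : op L by apply: op_cw.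
have Lu i w : laurent w -> L (um i w) = um i (L w).
  move=> lw; apply/funext => a; apply/funext => n; rewrite /L /cw.
  by rewrite -[slice a _]/(um i (slice a w)) Pu //; apply: laurent_slice.
have lL w : laurent w -> laurent (L w) by apply: op_laurent.
have lFv v : laurent v -> laurent (F v) by apply: op_laurent.
pose K v := v - L (F v).
have oK : op K by apply: op_sub (op_id _ _) (op_comp oL oF).
have Kraise d v : laurent v -> vanishes_below d v -> vanishes_below d.+1 (K v).
  apply: (raising oK) => [|h].
    split=> [s|i] w lw; rewrite /K.
      by rewrite Ft // /L cw_tm // (opB (op_tm _ s)) //; apply/lL/lFv.
    by rewrite Fu // Lu //; apply: lFv.
  rewrite /K (opB (op_at0 _ _)) //; last exact/lL/lFv.
  rewrite at0_cw (at0_tlocal (tlocal_linear_map lF)) // at0_csec.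
  by rewrite -[Psi0 _]/((Psi0 \o restr F) (csec h)) PF // subrr.
pose G v := neumann K (L v); have oG : op G by apply: op_comp oL; apply: op_neumann.
have GF : agree (G \o F) id.
  move=> v lv; rewrite -[LHS]/(neumann K (L (F v))).
  have -> : L (F v) = v - K v by rewrite /K opprB addrC subrK.
  exact: Kneumann.
have Linj w : laurent w -> cw (restr F) (L w) = w.
  move=> lw; apply/funext => a; apply/funext => n; rewrite /cw slice_cw.
  rewrite -[restr F _]/((restr F \o Psi0) (slice a w)) FP //.
  exact: laurent_slice.
have FG : agree (F \o G) id.
  move=> w lw; have lLw := lL w lw; have lGw : laurent (G w) by apply: op_laurent lw.
  rewrite -[LHS]/(F (G w)) -(Linj (F (G w))); last exact: lFv.
  have -> : L (F (G w)) = L w.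
    have := neumannK oK Kraise lLw; rewrite -/(G w) /K.
    by rewrite opprB addrC subrK.
  exact: Linj.
have lG w : laurent w -> laurent (G w) by apply: op_laurent.
have GFE v : laurent v -> G (F v) = v := GF v.
have FGE v : laurent v -> F (G v) = v := FG v.
exists G; split=> //; apply: linear_map_of_tu => //.
- move=> r w lw; rewrite -{1}(FGE w lw); case: (lF) => _ rF _ _ _.
  by rewrite -(rlinearZ rF) ?GFE //; [apply/laurentZ|]; apply: lG.
- split=> [s|i] w lw; rewrite -{1}(FGE w lw).
    by rewrite -Ft ?GFE //; [apply/laurent_tm|]; apply: lG.
  by rewrite -Fu ?GFE //; [apply/laurent_um|]; apply: lG.
- have pL w : pole_le (fun=> 0) w -> pole_le (fun=> 0) (L w).
    move=> pw; apply: pole_le_weak (pole_le_cw (c := 0) _ pw); first by move=> a; lia.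
    by move=> m x px; rewrite addr0; apply: (pole_le_linear_map lP).
  move=> w pw; apply: pole_le_neumann; last exact: pL.
  move=> x px; apply: pole_leB => //; apply: pL; exact: pole_le_linear_map.
Qed.

End Isomorphisms.

(** * Rational scalars and the comparison of F-bundles *)

Section RationalInverses.
Variables (k : fieldType) (char0 : [pchar k] =i pred0) (R : comPzRingType).
Variable iota : {rmorphism k -> R}.

Definition natinv (n : nat) : R := iota (n%:R^-1).

Lemma natinvP n : (0 < n)%N -> n%:R * natinv n = 1.
Proof.
move=> n0; rewrite /natinv -(rmorph_nat iota n) -rmorphM divff ?rmorph1 //.
by rewrite (proj1 (pcharf0P k) char0) -lt0n.
Qed.

End RationalInverses.

Theorem proposition1p2
  (k : fieldType) (char0 : [pchar k] =i pred0)
  (R : comPzRingType) (iota : {rmorphism k -> R}) (dimR : countable_dim iota)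
  (I1 I2 : countType) (X1 : Fdata R I1) (X2 : Fdata R I2)
  (FX1 : is_Fbundle X1) (FX2 : is_Fbundle X2)
  (f : ser I2 R -> ser I1 R) (Phi : lser I1 (fcar X1) -> lser I1 (fcar X2))
  (mor : is_Tmorphism (forget X1) (forget X2) f Phi)
  (fr : admits_framing (forget X1)) :
  [/\ (forall D : lser I1 (fcar X1) -> lser I1 (fcar X1),
         is_Fbundle (with_nu (forget X1) D) ->
         agree (restr D) (restr (fnu X1)) ->
         agree D (fnu X1)),
      (forall delta : lser void (fcar X1) -> lser void (fcar X1),
         is_conn (@du void R) (fun=> 2) delta ->
         exists D : lser I1 (fcar X1) -> lser I1 (fcar X1),
         [/\ flat_extension (forget X1) (fun a => 2 + (mdeg a)%:Z) D,
             agree (restr D) delta,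
             (forall D' : lser I1 (fcar X1) -> lser I1 (fcar X1),
                flat_extension (forget X1) (fun a => 2 + (mdeg a)%:Z) D' ->
                agree (restr D') delta -> agree D' D)
           & (forall D' : lser I1 (fcar X1) -> lser I1 (fcar X1),
                is_Fbundle (with_nu (forget X1) D') ->
                agree (restr D') delta ->
                is_Fbundle (with_nu (forget X1) D) /\ agree D' D)])
    & is_Fisomorphism X1 X2 f Phi <->
      is_Fiso (restrF X1) (restrF (pullF f X2)) (restr Phi)].
Proof.
pose inv := natinv iota; have invP := natinvP char0 iota.
have tf H := @torsion_free R H inv invP.
move: FX1 => [[free1 cN1 NC1] [cD1 ND1]]; move: FX2 => [[free2 cN2 NC2] [cD2 ND2]].
have dN1 s : is_dt_conn s (fnt X1 s) := conn_is_dt (cN1 s).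
split.
- move=> D [_ [cD ND]] DD1; exact: (flat_extension_unique (@tf _) dN1 cD1 ND1 cD ND DD1).
- move=> delta cdelta; pose D := flat_ext inv (fnt X1) delta.
  have cD : is_conn (@du I1 R) (fun a => 2 + (mdeg a)%:Z) D by apply: flat_ext_conn.
  have ND s : commutes (fnt X1 s) D by apply: flat_ext_commutes.
  have rD : agree (restr D) delta by apply: restr_flat_ext.
  have uniq p D' : is_conn (@du I1 R) p D' -> (forall s, commutes (fnt X1 s) D') ->
      agree (restr D') delta -> agree D' D.
    move=> cD' ND' rD'; apply: (flat_extension_unique (@tf _) dN1 cD ND cD' ND').
    by move=> w lw; rewrite rD' // rD.
  exists D; split=> // [D' [cD' ND'] rD'|D' [_ [cD' ND']] rD']; first exact: uniq cD' ND' rD'.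
  have D'D := uniq _ _ cD' ND' rD'; split=> //.
  split; first by split.
  split; last exact: ND.
  (* D agrees with D', whose pole has order at most 2. *)
  case: (cD) => lD RD LD _ KD; split=> // v pv.
  change (pole_le (fun=> 2) (D v)).
  by rewrite -D'D; [case: cD' => _ _ _ pD' _; apply: pD'|exists (fun=> 0)].
- case: mor => falg lPhi PhiN.
  have cPN s : is_conn (@dt I1 R s) (fun=> 1) (pull_nt f (fnt X2) s).
    exact: conn_pull_nt.
  have cPD : is_conn (@du I1 R) (fun=> 2) (pull_nu f (fnu X2)) by apply: conn_pull_nu.
  have oD1 := op_conn (derivation_du I1 _) cD1; have oPD := op_conn (derivation_du I1 _) cPD.
  have oPhi := op_linear_map lPhi.
  have locPhi := tlocal_linear_map lPhi; have locPD := tlocal_conn_du cPD.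
  split=> [[_ [[isoPhi _] PhiD]]|[[isoPhi0 _] PhiD0]].
    split; first by split; [exact: linear_iso_restr|case].
    move=> w lw; have ll := op_laurent (op_lift0 I1 _) lw.
    rewrite -[LHS]/(restr Phi (restr (fnu X1) w)) (restr_comp locPhi) //.
    rewrite -[RHS]/(restr (pull_nu f (fnu X2)) (restr Phi w)) (restr_comp locPD) //.
    by congr at0; apply: PhiD.
  split=> //; split; first by split=> //; apply: linear_iso_of_restr.
  pose E v := Phi (fnu X1 v) - pull_nu f (fnu X2) (Phi v).
  have oE : op E by apply: op_sub; apply: op_comp.
  suff E0 v : laurent v -> E v = 0 by move=> v /E0 /subr0_eq.
  apply: (@intertwiner_eq0 I1 _ _ (@tf _) (fnt X1) (pull_nt f (fnt X2))) => // {v}.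
  + by move=> s v; apply/op_laurent/op_dt_conn.
  + by move=> s; apply: conn_is_dt.
  + by move=> v; apply: op_laurent.
  + move=> s v lv; have oPN := op_conn (derivation_dt _ s) (cPN s).
    have lD1v := op_laurent oD1 lv; have lPv := op_laurent oPhi lv.
    have lN1v := op_laurent (op_dt_conn (dN1 s)) lv.
    rewrite /E (opB oPN); [|exact: op_laurent lD1v|exact: op_laurent lPv].
    congr (_ - _).
      rewrite -[LHS]/((tnt (pullT f (forget X2)) s \o Phi) (fnu X1 v)) -PhiN //=.
      by congr Phi; apply: ND1.
    rewrite -[LHS]/((pull_nt f (fnt X2) s \o pull_nu f (fnu X2)) (Phi v)).
    rewrite (pull_flat falg cN2 cD2 ND2) //=; congr pull_nu.
    by symmetry; apply: PhiN.
  + move=> v lv; have lD1v := op_laurent oD1 lv; have lPv := op_laurent oPhi lv.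
    have lv0 := op_laurent (op_at0 _ _) lv.
    rewrite /E (opB (op_at0 _ _)); [|exact: op_laurent lD1v|exact: op_laurent lPv].
    rewrite (at0_tlocal locPhi) // (at0_tlocal (tlocal_conn_du cD1)) //.
    rewrite (at0_tlocal locPD) // (at0_tlocal locPhi) //.
    by apply/eqP; rewrite subr_eq0; apply/eqP; apply: PhiD0.
Qed.
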